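(* Let $\alpha$ be an irrational number that is not of golden type, let $T_\alpha:X_\alpha\to X_\alpha$ be the cutting-and-stacking transformation and $f_\alpha:X_\alpha\to\mathbb{S}^1$ its eigenfunction with eigenvalue $e^{2\pi i\alpha}$, both described in the context. Let $R_\alpha:\mathbb{S}^1\to\mathbb{S}^1$, $R_\alpha(z)=e^{2\pi i\alpha}z$, and let $\nu=m\circ f_\alpha^{-1}$. Then $f_\alpha$ is an isomorphism (after removing null sets) between the dynamical systems $(X_\alpha,m,T_\alpha)$ and $(\mathbb{S}^1,\nu,R_\alpha)$. Moreover, if $m(X_\alpha)<\infty$, then $\nu$ equals, up to a constant multiple, Lebesgue measure on $\mathbb{S}^1$, so that $T_\alpha$ is a cutting-and-stacking representation of the irrational rotation $R_\alpha$.
   Context: For an irrational $\alpha=[a_0;a_1,a_2,\dots]$ put $q_0=0,\ q_1=1$ and $q_k=a_{k-1}q_{k-1}+q_{k-2}$ for $k\ge 2$. $\alpha$ is of golden type if there is $n$ with $a_k=1$ for all $k\ge n$. Construction of $T_\alpha$ ($\alpha$ irrational, not of golden type). All intervals are left-open and right-closed. The column $C_1$ consists of one level, the unit interval. Suppose the column $C_k$, consisting of $q_k$ disjoint intervals of equal length (levels) $C_k(0),\dots,C_k(q_k-1)$, has been constructed. Cut each level $C_k(n)$ into $a_k$ subintervals of equal length, from left to right $C_k^0(n),\dots,C_k^{a_k-1}(n)$, so that $C_k$ is cut into $a_k$ sub-columns. Stack these from left (bottom) to right (top) and add on top $q_{k-1}$ new disjoint intervals (spacers) of the same length taken from $\mathbb{R}\setminus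 C_k$. Thus $C_{k+1}$ has $q_{k+1}=a_kq_k+q_{k-1}$ levels, with $C_{k+1}(jq_k+n)=C_k^j(n)$ for $0\le j<a_k$, $0\le n<q_k$, and with $C_{k+1}(a_kq_k+i)$, $0\le i<q_{k-1}$, the spacers. We also write $C_k$ for the union of its levels. Let $X_\alpha=\bigcup_k C_k$, with Lebesgue measure $m$, and let $T_\alpha:X_\alpha\to X_\alpha$ map each non-top level $C_k(i)$, $0\le i<q_k-1$, by translation onto $C_k(i+1)$, for all $k$. The eigenfunction $f_\alpha$. Let $\lambda=e^{2\pi i\alpha}$. Let $g_k=\lambda^n$ on $C_k(n)$ and $g_k=0$ on $X_\alpha\setminus C_k$. Let $f_k=g_k$ on $C_k$ and $f_k=g_j$ on $C_j\setminus C_{j-1}$ for all $j\ge k+1$. The sequence $(f_k)$ converges uniformly (in $L^\infty$), and $f_\alpha=\lim_k f_k$; it satisfies $f_\alpha\circ T_\alpha=e^{2\pi i\alpha}f_\alpha$. *)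

(* Defs.v *)
From HB Require Import structures.
From mathcomp Require Import all_boot all_order all_algebra complex.
From mathcomp Require Import all_classical all_reals all_analysis.

Set Implicit Arguments.
Unset Strict Implicit.
Unset Printing Implicit Defensive.

Import Order.TTheory GRing.Theory Num.Theory.
Import numFieldNormedType.Exports.

Local Open Scope classical_set_scope.
Local Open Scope ring_scope.
Local Open Scope complex_scope.

Section ContinuedFraction.
Context {R : realType}.

(* alpha_0 = alpha, alpha_(k+1) = 1 / (alpha_k - floor alpha_k), so that
   alpha = [a_0; a_1, a_2, ...] with a_k = floor alpha_k. *)
Fixpoint complete_quotient (alpha : R) (k : nat) : R :=
  if k is l.+1 then
    (complete_quotient alpha l - (Num.floor (complete_quotient alpha l))%:~R)^-1
  else alpha.

Definition partial_quotient (alpha : R) (k : nat) : int :=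
  Num.floor (complete_quotient alpha k).

(* Only a_0 can be negative, and a_0 plays no role in the construction: for
   irrational alpha and k >= 1 this is a_k as a positive natural number. *)
Definition cuts (alpha : R) (k : nat) : nat := `|partial_quotient alpha k|%N.

Definition golden_type (alpha : R) : Prop :=
  exists n, forall k, (n <= k)%N -> partial_quotient alpha k = 1.

End ContinuedFraction.

Section CuttingAndStacking.
Context {R : realType}.

(* a k : number of sub-columns into which C_k is cut;
   s k i : left endpoint of the i-th spacer added on top of C_k.
   The columns of the construction are C_k for k >= 1; since q_0 = 0, the
   column of index 0 is empty, and the values at k = 0 below are dummies. *)
Implicit Types (a : nat -> nat) (s : nat -> nat -> R).

Fixpoint height a (k : nat) : nat :=
  match k with
  | 0 => 0
  | 1 => 1
  | (m.+1 as l).+1 => a l * height a l + height a m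
  end%N.

Fixpoint width a (k : nat) : R :=
  if k is l.+1 then
    if l == 0%N then 1 else width a l / (a l)%:R
  else 1.

(* Left endpoint of the level C_k(n): level jq_k + n of C_(k+1) is the j-th
   piece C_k^j(n) of C_k(n), and level a_k q_k + i is the i-th spacer. *)
Fixpoint left_end a s (k n : nat) : R :=
  if k is l.+1 then
    if l == 0%N then 0
    else if (n < a l * height a l)%N then
      left_end a s l (n %% height a l)
        + (n %/ height a l)%:R * width a l.+1
    else s l (n - a l * height a l)%N
  else 0.

Definition level a s (k n : nat) : set R :=
  `]left_end a s k n, left_end a s k n + width a k]%classic.

Definition column a s (k : nat) : set R :=
  \bigcup_(n in [set n | (n < height a k)%N]) level a s k n.

Definition spacer a s (k i : nat) : set R :=
  level a s k.+1 (a k * height a k + i).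

Definition valid_spacers a s : Prop :=
  forall k, (0 < k)%N ->
    trivIset [set i | (i < height a k.-1)%N] (spacer a s k) /\
    forall i, (i < height a k.-1)%N -> spacer a s k i `&` column a s k = set0.

Definition tower_space a s : set R := \bigcup_k column a s k.

(* T maps a non-top level C_k(i) onto C_k(i+1) by translation, for all k. *)
Definition tower_map a s (x : R) : R :=
  xget x [set y | exists k i,
    [/\ (i.+1 < height a k)%N, level a s k i x &
        y = x + (left_end a s k i.+1 - left_end a s k i)]].

End CuttingAndStacking.

Section Circle.
Context {R : realType}.

(* C with its Borel sigma-algebra (R[i]^o is R[i] with its usual topology). *)
Definition borelC : measurableType _ := g_sigma_algebraType (@open (R[i]^o)).

Definition expi (t : R) : R[i] := cos t +i* sin t.

Definition circle : set borelC := [set z : R[i] | `|z| = 1].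

Definition rotation (alpha : R) (z : borelC) : borelC :=
  expi (2 * pi * alpha) * (z : R[i]).

(* Lebesgue measure on the circle, normalised to total mass 1. *)
Definition circle_lebesgue (A : set borelC) : \bar R :=
  lebesgue_measure
    (`[0, 1[%classic `&` (fun t : R => expi (2 * pi * t)) @^-1` A).

End Circle.
Arguments borelC : clear implicits.
Arguments circle : clear implicits.

Section Eigenfunction.
Context {R : realType}.
Implicit Types (alpha : R) (s : nat -> nat -> R).

Definition eigen_g alpha s (k : nat) (x : R) : R[i] :=
  \sum_(n < height (cuts alpha) k)
    expi (2 * pi * alpha) ^+ n * \1_(level (cuts alpha) s k n) x.

(* f_k = g_k on C_k and f_k = g_j on C_j \ C_(j-1) for j > k (0 off X). *)
Definition eigen_approx alpha s (k : nat) (x : R) : R[i] :=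
  if x \in column (cuts alpha) s k then eigen_g alpha s k x
  else xget 0 [set z | exists j,
    [/\ (k < j)%N,
        (column (cuts alpha) s j `\` column (cuts alpha) s j.-1) x &
        z = eigen_g alpha s j x]].

Definition eigenfunction alpha s (x : R) : borelC R :=
  lim ((fun k => eigen_approx alpha s k x : R[i]^o) @ \oo).

(* The image measure m o f^-1, m being Lebesgue measure on X. *)
Definition image_measure alpha s (A : set (borelC R)) : \bar R :=
  lebesgue_measure
    (tower_space (cuts alpha) s `&` eigenfunction alpha s @^-1` A).

End Eigenfunction.

Section Isomorphism.
Context {R : realType} {d1 d2 : measure_display}.

(* A system (D, mu, S) lives on a measurable subset D of a measurable space;
   only the values of mu on measurable subsets of D, and those of S on D,
   matter. *)
Definition measure_preserving d (T : measurableType d)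
    (D : set T) (mu : set T -> \bar R) (S : T -> T) : Prop :=
  [/\ measurable D, set_fun D D S, measurable_fun D S &
      forall A, measurable A -> A `<=` D -> mu (D `&` S @^-1` A) = mu A].

(* f is an isomorphism after removal of null sets: it restricts to a
   bimeasurable, equivariant, measure-preserving bijection between forward
   invariant subsets of full measure. *)
Definition isomorphism (T1 : measurableType d1) (T2 : measurableType d2)
    (D1 : set T1) (mu1 : set T1 -> \bar R) (S1 : T1 -> T1)
    (D2 : set T2) (mu2 : set T2 -> \bar R) (S2 : T2 -> T2)
    (f : T1 -> T2) : Prop :=
  [/\ measure_preserving D1 mu1 S1, measure_preserving D2 mu2 S2 &
  exists E1 E2,
    [/\ [/\ measurable E1, E1 `<=` D1, mu1 (D1 `\` E1) = 0%E &
            set_fun E1 E1 S1],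
        [/\ measurable E2, E2 `<=` D2, mu2 (D2 `\` E2) = 0%E &
            set_fun E2 E2 S2],
        set_bij E1 E2 f /\ (forall x, E1 x -> f (S1 x) = S2 (f x)),
        measurable_fun E1 f /\
          (forall A, measurable A -> A `<=` E1 -> measurable (f @` A)) &
        forall B, measurable B -> B `<=` E2 -> mu1 (E1 `&` f @^-1` B) = mu2 B]].

End Isomorphism.

(* Main.v *)
Require Import Defs.
From mathcomp Require Import all_boot all_order all_algebra complex.
From mathcomp Require Import all_classical all_reals all_analysis.
From mathcomp Require Import measurable_realfun.
From mathcomp Require Import ring lra zify.
Import Order.TTheory GRing.Theory Num.Theory.
Import numFieldNormedType.Exports.

(** Let lambda = e^(2 pi i alpha) and delta_k = q_k alpha - p_k, where p_k / q_k
    are the convergents of alpha; the delta_k alternate in sign and their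
    absolute values [gap] satisfy |delta_(k-1)| = a_k |delta_k| + |delta_(k+1)|.
    On level n of C_k the approximation g_k is the constant lambda^n, and a point
    of that level which then falls in the pieces numbered d_k, d_(k+1), ... of
    the successive cuttings has the eigenfunction value
    lambda^n e^(2 pi i sum_(j >= k) d_j delta_j): its address in the tower is an
    Ostrowski expansion of the argument of f.

    The digits satisfy d_j <= a_j - 1, so two such sums with the same k differ
    by at most sum_(j >= k) (a_j - 1) |delta_j|, which telescopes to at most
    |delta_(k-1)| - |delta_(k+1)| ([digit_sum_bound]).  For distinct levels
    m, n < q_k, the number (m - n) alpha is at distance at least |delta_(k-1)|
    from the integers ([best_approximation]).  Hence f maps distinct levels of
    one column to sets at positive distance ([eigenfunction_separated]), while
    the image of one level of C_k has a diameter tending to 0 with k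
    ([eigenfunction_near]).

    If alpha is not of golden type, infinitely many a_k are at least 2 and the
    widths of the levels tend to 0.  Then distinct points of X eventually lie in
    distinct levels, and f is injective on all of X ([eigenfunction_inj]).  Also
    the bottom levels ]0, w_k] shrink to the empty set, so that T is a piecewise
    translation of X onto itself and preserves Lebesgue measure
    ([tower_map_measure]).  A point of the circle which, for every j >= k, lies
    in the closure of the image of some level of C_j contained in a given level of
    C_k is a value of f on that level, unless it is one of the countably many
    powers of lambda ([level_trap_sub]); so the images of levels, and then of all
    Borel subsets of X, are Borel.  Therefore f
    is an isomorphism from X onto f(X), no null set being removed from X, and
    f(X) has full image measure.

    If X has finite measure, the image measure is a finite measure on the circle
    invariant under an irrational rotation, hence a multiple of Lebesgue measure
    ([unique_ergodicity]): with theta the fractional part of alpha and M the total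
    mass, the mass F(t) of the arc of arguments [0, t[ satisfies
    F(n theta - m) = n F(theta) - m M; as F is bounded, F(theta) = M theta, and F
    is linear because it is monotone and the orbit of theta is dense. *)

Set Implicit Arguments.
Unset Strict Implicit.
Unset Printing Implicit Defensive.
Local Open Scope classical_set_scope.
Local Open Scope ring_scope.
Local Open Scope complex_scope.
Import Normc.
Local Notation Re := complex.Re.
Local Notation Im := complex.Im.

(** * Continued fractions and best approximation *)

Section ContinuedFractionTheory.
Context {R : realType} (alpha : R).
Hypothesis alpha_irr : irrational alpha.

Local Notation cq := (complete_quotient alpha).
Local Notation a := (cuts alpha).
Local Notation q := (height a).

Definition cq_frac k : R := cq k - (Num.floor (cq k))%:~R.

Lemma rational_int (z : int) : rational (z%:~R : R).
Proof. by exists z%:~R => //; rewrite ratr_int. Qed.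

Lemma cq_irr k : irrational (cq k).
Proof.
elim: k => [|k IH] //= -[r _ rE]; apply: IH.
exists (r^-1 + (Num.floor (cq k))%:~R) => //.
have h : (ratr r : R) = (cq_frac k)^-1 := rE.
rewrite rmorphD /= fmorphV ratr_int [X in X^-1 + _](_ : _ = (cq_frac k)^-1) //.
by rewrite invrK subrK.
Qed.

Lemma cq_frac_gt0 k : 0 < cq_frac k.
Proof.
rewrite subr_gt0 lt_neqAle floor_le andbT.
by apply/eqP => E; apply: (@cq_irr k); rewrite -E; exact: rational_int.
Qed.

Lemma cq_frac_lt1 k : cq_frac k < 1.
Proof. by rewrite ltrBlDl; have := floorD1_gt (cq k); rewrite intrD. Qed.

Lemma cqS k : cq k.+1 = (cq_frac k)^-1. Proof. by []. Qed.

(** Each complete quotient of positive index is the inverse of a number in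
    ]0, 1[, so it exceeds 1 and its floor is a positive integer. *)
Lemma cuts_floor k : (0 < k)%N -> Num.floor (cq k) = a k /\ (0 < a k)%N.
Proof.
case: k => // k _.
have h : 1 <= Num.floor (cq k.+1).
  by rewrite floor_ge_int cqS invf_ge1 ?cq_frac_gt0 // ltW // cq_frac_lt1.
rewrite /cuts /partial_quotient; split; last by rewrite absz_gt0; lia.
by rewrite gez0_abs //; lia.
Qed.

Lemma cuts_gt0 k : (0 < k)%N -> (0 < a k)%N.
Proof. by case/cuts_floor. Qed.

Lemma cutsE k : (0 < k)%N -> (a k)%:R = (Num.floor (cq k))%:~R :> R.
Proof. by case/cuts_floor => -> _. Qed.

Lemma cuts_ge2 : ~ golden_type alpha ->
  forall N, exists k, [/\ (N <= k)%N, (0 < k)%N & (1 < a k)%N].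
Proof.
move=> ng N; apply: contrapT => h; apply: ng; exists N.+1 => k Nk.
have k0 : (0 < k)%N by lia.
have [aE a0] := cuts_floor k0.
have : ~ (1 < a k)%N by move=> ak; apply: h; exists k; split => //; lia.
by rewrite /partial_quotient aE; lia.
Qed.

(** The distances |q_k alpha - p_k|, as products of the fractional parts of
    the complete quotients; see [convergent_error]. *)
Fixpoint gap k : R := if k is l.+1 then gap l * cq_frac l else 1.

Lemma gap_gt0 k : 0 < gap k.
Proof. by elim: k => //= k IH; rewrite mulr_gt0 // cq_frac_gt0. Qed.

Lemma gap_decr k : gap k.+1 <= gap k.
Proof. by rewrite /= ger_pMr ?gap_gt0 // ltW // cq_frac_lt1. Qed.

(** The recurrence of the numbers q_k alpha - p_k, for their absolute values:
    the signs alternate, so the sum becomes a difference. *)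
Lemma gapSS k : gap k.+2 = gap k - (a k.+1)%:R * gap k.+1.
Proof.
rewrite cutsE // -[gap k.+2]/(gap k.+1 * cq_frac k.+1) {1}/cq_frac mulrBr.
rewrite cqS [in X in X - _]/= -mulrA mulfV ?mulr1 1?[in RHS]mulrC //.
by rewrite gt_eqF // cq_frac_gt0.
Qed.

(** Since a_(k+1) >= 1, the recurrence gives gap (k+2) + gap (k+1) <= gap k,
    and the first summand is the smaller one. *)
Lemma gap_half k : gap k.+2 <= gap k / 2.
Proof.
have : gap k.+1 <= (a k.+1)%:R * gap k.+1.
  by rewrite ler_peMl ?ler1n ?cuts_gt0 // ltW // gap_gt0.
have := gap_decr k.+1; rewrite !gapSS; lra.
Qed.

Lemma gap_le m n : (m <= n)%N -> gap n <= gap m.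
Proof.
elim: n => [|n IH]; first by rewrite leqn0 => /eqP ->.
rewrite leq_eqVlt => /predU1P[-> //|/IH]; exact/le_trans/gap_decr.
Qed.

Lemma gap_small e : 0 < e -> exists N, forall k, (N <= k)%N -> gap k < e.
Proof.
move=> e0.
have h n : gap n.*2 <= (2 ^+ n)^-1.
  elim: n => [|n IH]; first by rewrite expr0 invr1.
  by rewrite doubleS (le_trans (gap_half _)) // exprS invfM mulrC ler_pM2l.
have [n hn] : exists n, (2 ^+ n)^-1 < e.
  exists (Num.truncn e^-1).+1; rewrite invf_plt ?posrE ?exprn_gt0 //.
  apply: (lt_trans (truncnS_gt _)).
  by rewrite -natrX ltr_nat ltn_expl.
exists n.*2 => k nk.
by rewrite (le_lt_trans (gap_le nk)) // (le_lt_trans (h n)).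
Qed.

(** The numerators p_k, for the convention p_0 = 1, q_0 = 0. *)
Fixpoint numer k : int :=
  match k with
  | 0 => 1
  | 1 => Num.floor alpha
  | (m.+1 as l).+1 => Posz (a l) * numer l + numer m
  end.

Lemma heightSS k : q k.+2 = (a k.+1 * q k.+1 + q k)%N. Proof. by []. Qed.
Lemma numerSS k : numer k.+2 = Posz (a k.+1) * numer k.+1 + numer k. Proof. by []. Qed.

Lemma convergent_error k :
  (q k)%:R * alpha - (numer k)%:~R = (-1) ^+ k.+1 * gap k.
Proof.
have [//] : (q k)%:R * alpha - (numer k)%:~R = (-1) ^+ k.+1 * gap k /\
  (q k.+1)%:R * alpha - (numer k.+1)%:~R = (-1) ^+ k.+2 * gap k.+1.
elim: k => [|k [IH1 IH2]].
  by rewrite /= /cq_frac /= expr1 expr2; split; lra.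
split => //; rewrite heightSS numerSS gapSS natrD natrM intrD intrM.
have -> : (-1) ^+ k.+3 = (-1) ^+ k.+1 :> R by rewrite !exprS; ring.
move: IH1 IH2; rewrite [(-1) ^+ k.+2]exprS.
set A := (q k)%:R; set B := (q k.+1)%:R; set P := (numer k)%:~R.
set Q := (numer k.+1)%:~R; set s := (-1) ^+ k.+1 => IH1 IH2.
have -> : (Posz (a k.+1))%:~R = (a k.+1)%:R :> R by [].
set c := (a k.+1)%:R.
have -> : (c * B + A) * alpha - (c * Q + P) =
  c * (B * alpha - Q) + (A * alpha - P) by ring.
by rewrite IH1 IH2; ring.
Qed.

Lemma convergent_det k :
  Posz (q k.+1) * numer k - Posz (q k) * numer k.+1 = (-1) ^+ k.
Proof.
elim: k => [|k IH]; first by rewrite /= mul0r subr0.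
rewrite exprS -IH heightSS numerSS PoszD PoszM; ring.
Qed.

(** By [convergent_det] the pair (m, p) is an integer combination, with
    coefficients u and v, of (q_(k+1), p_(k+1)) and (q_k, p_k). As 0 < m <
    q_(k+1), v is nonzero and u has not the sign of v; the errors of the two
    convergents have opposite signs, so their contributions to m alpha - p add
    up in absolute value and that of v is at least gap k. *)
Lemma best_approximation k (m : nat) (p : int) :
  (0 < m < q k.+1)%N -> gap k <= `|m%:R * alpha - p%:~R|.
Proof.
move=> /andP[m0 mq].
(* the solution of the linear system, by Cramer rule *)
pose u : int := (-1) ^+ k * (Posz m * numer k - p * Posz (q k)).
pose v : int := (-1) ^+ k * (Posz (q k.+1) * p - numer k.+1 * Posz m).
have sq : (-1) ^+ k * (-1) ^+ k = 1 :> int by rewrite -expr2 sqrr_sign.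
have mE : Posz m = u * Posz (q k.+1) + v * Posz (q k).
  transitivity ((-1) ^+ k *
    (Posz (q k.+1) * numer k - Posz (q k) * numer k.+1) * Posz m).
    by rewrite convergent_det sq mul1r.
  rewrite /u /v; ring.
have pE : p = u * numer k.+1 + v * numer k.
  transitivity ((-1) ^+ k *
    (Posz (q k.+1) * numer k - Posz (q k) * numer k.+1) * p).
    by rewrite convergent_det sq mul1r.
  rewrite /u /v; ring.
clearbody u v.
have -> : m%:R * alpha - p%:~R =
    (-1) ^+ k * (u%:~R * gap k.+1 - v%:~R * gap k).
  have -> : m%:R = u%:~R * (q k.+1)%:R + v%:~R * (q k)%:R :> R.
    by rewrite -[m%:R]/((Posz m)%:~R) mE intrD !intrM.
  rewrite {1}pE intrD !intrM.
  have E1 := convergent_error k; have E2 := convergent_error k.+1.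
  rewrite !exprS in E1 E2; move: E1 E2.
  set A := (q k)%:R; set B := (q k.+1)%:R; set P := (numer k)%:~R.
  set Q := (numer k.+1)%:~R; set s := (-1) ^+ k => E1 E2.
  transitivity (u%:~R * (B * alpha - Q) + v%:~R * (A * alpha - P)); first ring.
  by rewrite E1 E2; ring.
rewrite normrM normrX normrN1 expr1n mul1r.
have g1 := gap_gt0 k.+1; have g0 := gap_gt0 k.
(* u and v cannot both be positive or both be nonpositive, since 0 < m < q_(k+1) *)
have [v0|v0] := ltP 0 v.
  have u0 : u <= 0 by nia.
  rewrite distrC ler_normr; apply/orP; left.
  have : (1 : R) <= v%:~R by rewrite ler1z; lia.
  have : u%:~R <= 0 :> R by rewrite lerz0.
  nra.
have [v1|v1] := ltP v 0; last first.
  have v00 : v = 0 by lia.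
  have : (0 < u) && (u < 1) by rewrite v00 in mE; nia.
  by lia.
have u0 : 0 <= u by nia.
rewrite ler_normr; apply/orP; left.
have : v%:~R <= -1 :> R by rewrite -(mulrN1z 1) ler_int; lia.
have : 0 <= u%:~R :> R by rewrite ler0z.
nra.
Qed.

(** The terms a_j gap j = gap (j-1) - gap (j+1) telescope. The digit bound
    a_j - 1, in place of the bound a_j of general Ostrowski expansions, leaves
    the margin gap (k+1) that separates the levels. *)
Lemma digit_sum_bound k K : (0 < k <= K)%N ->
  \sum_(k <= j < K) ((a j)%:R - 1) * gap j <= gap k.-1 - gap k.+1.
Proof.
move=> /andP[k0 kK]; have [k' kE] : exists k', k = k'.+1 by exists k.-1; lia.
rewrite {}kE in kK *; clear k k0; rewrite [k'.+1.-1]/=.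
case: (leqP K k'.+1) => [Kk|Kk].
  rewrite big_geq // subr_ge0; exact/gap_le/leqW/leqW.
have [n ->] : exists n, K = (k'.+2 + n)%N by exists (K - k'.+2)%N; lia.
(* the extra term gap (K - 1) makes the bound inductive *)
suff : \sum_(k'.+1 <= j < k'.+2 + n) ((a j)%:R - 1) * gap j <=
    gap k' - gap k'.+2 - gap (k'.+1 + n).
  by have := gap_gt0 (k'.+1 + n); lra.
elim: n => [|n IH].
  by rewrite !addn0 big_nat1 gapSS; lra.
rewrite addnS big_nat_recr; last by lia.
have := gapSS (k'.+1 + n); have := gap_gt0 (k'.+1 + n).+2.
rewrite addnS -!addSn => h1 h2.
move: IH h1 h2.
set S := bigop _ _ _; set A := gap k'; set B := gap k'.+2.
set C := gap (k'.+1 + n); set D := gap _; set E := gap _; set c := (a _)%:R.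
by change (S <= A - B - C -> 0 < D -> D = C - c * E -> S + (c - 1) * E <= A - B - E); lra.
Qed.

(** The address of a point in column j+1 is d q_j plus its address in column
    j, where d < a_j is the number of its piece. Sequences of this form, from
    index k on, represent the itineraries of the points of column k. *)
Definition digits (k : nat) (u : nat -> nat) :=
  forall j, (k <= j)%N -> exists2 d, (d < a j)%N & u j.+1 = (d * q j + u j)%N.

Lemma digits_angle k K u v : (0 < k <= K)%N -> digits k u -> digits k v ->
  exists p : int, `|((u K)%:R - (v K)%:R) * alpha -
     ((u k)%:R - (v k)%:R) * alpha - p%:~R| <=
     \sum_(k <= j < K) ((a j)%:R - 1) * gap j.
Proof.
move=> /andP[k0 kK] hu hv.
have [n ->] : exists n, K = (k + n)%N by exists (K - k)%N; lia.
elim: n => [|n [p IH]].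
  by exists 0; rewrite addn0 big_geq // !subrr normr0.
rewrite addnS big_nat_recr /=; last by lia.
have [d da ->] := hu (k + n)%N (leq_addr _ _).
have [e ea ->] := hv (k + n)%N (leq_addr _ _).
set j := (k + n)%N in IH da ea *.
(* d q_j alpha is d p_j up to d times the error of the convergent *)
exists (p + (Posz d - Posz e) * numer j).
set D := (d%:R - e%:R) * ((-1) ^+ j.+1 * gap j).
have -> : ((d * q j + u j)%:R - (e * q j + v j)%:R) * alpha -
    ((u k)%:R - (v k)%:R) * alpha - (p + (Posz d - Posz e) * numer j)%:~R =
   (((u j)%:R - (v j)%:R) * alpha - ((u k)%:R - (v k)%:R) * alpha - p%:~R) + D.
  rewrite /D -convergent_error !natrD !natrM intrD intrM intrB.
  rewrite -[(Posz d)%:~R]/(d%:R) -[(Posz e)%:~R]/(e%:R); ring.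
rewrite (le_trans (ler_normD _ _)) // lerD // /D !normrM normrX normrN1 expr1n.
rewrite mul1r (gtr0_norm (gap_gt0 _)) ler_pM2r ?gap_gt0 //.
have d0 : 0 <= d%:R :> R by []. 
have e0 : 0 <= e%:R :> R by []. 
have : d.+1%:R <= (a j)%:R :> R by rewrite ler_nat.
have : e.+1%:R <= (a j)%:R :> R by rewrite ler_nat.
rewrite -!natr1 => h1 h2; rewrite ler_norml; apply/andP; split; lra.
Qed.

(** Two itineraries that start together stay within gap (k-1) modulo 1. *)
Lemma digits_near k K u v : (0 < k <= K)%N -> digits k u -> digits k v ->
  u k = v k ->
  exists p : int, `|((u K)%:R - (v K)%:R) * alpha - p%:~R| <= gap k.-1.
Proof.
move=> kK hu hv uv; have [p hp] := digits_angle kK hu hv; exists p.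
move: hp; rewrite uv subrr mul0r subr0 => /le_trans; apply.
have := digit_sum_bound kK; have := gap_gt0 k.+1; lra.
Qed.

(** The starting distance modulo 1 is at least gap (k-1) by
    [best_approximation], and the digits can reduce it by at most gap (k-1) -
    gap (k+1). *)
Lemma digits_separated k K u v : (0 < k <= K)%N -> digits k u -> digits k v ->
  (u k < q k)%N -> (v k < q k)%N -> u k != v k ->
  forall p : int, gap k.+1 <= `|((u K)%:R - (v K)%:R) * alpha - p%:~R|.
Proof.
move=> kK hu hv uq vq uv r.
wlog vu : u v hu hv uq vq uv r / (v k < u k)%N => [hw|].
  have [h|h] := ltnP (v k) (u k); first exact: hw.
  have := hw v u hv hu vq uq; rewrite eq_sym => /(_ uv (- r)).
  rewrite -normrN intrN opprD !opprK -mulNr opprB; apply.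
  by rewrite ltn_neqAle uv h.
have [p hp] := digits_angle kK hu hv.
have := digit_sum_bound kK.
case: k kK hu hv uq vq uv vu hp => // k kK hu hv uq vq uv vu hp.
have hm : (0 < u k.+1 - v k.+1 < q k.+1)%N by lia.
have := best_approximation (r - p) hm.
rewrite natrB ?(ltnW vu) // intrB /= -/(gap k.+1) => h1 h2.
set A := ((u K)%:R - _) * _ in hp *.
set B := ((u k.+1)%:R - _) * _ in hp h1.
have E : B - (r%:~R - p%:~R) = (A - r%:~R) - (A - B - p%:~R) by ring.
move: h1; rewrite E => /le_trans /(_ (ler_normB _ _)).
by move: hp h2 => /=; lra.
Qed.

End ContinuedFractionTheory.

(** * The tower: levels, columns and the tower map *)

Section Tower.
Context {R : realType} (a : nat -> nat) (s : nat -> nat -> R).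
Hypothesis a_gt0 : forall k, (0 < k)%N -> (0 < a k)%N.
Hypothesis s_valid : valid_spacers a s.

Local Notation q := (height a).
Local Notation w := (width a : nat -> R).
Local Notation le := (left_end a s).
Local Notation lev := (level a s).
Local Notation col := (column a s).

Lemma heightS k : (0 < k)%N -> q k.+1 = (a k * q k + q k.-1)%N.
Proof. by case: k. Qed.

Lemma height_gt0 k : (0 < k)%N -> (0 < q k)%N.
Proof.
elim: k => // -[|k] IH // _; rewrite heightS // addn_gt0 muln_gt0 IH //.
by rewrite a_gt0.
Qed.

Lemma widthS k : (0 < k)%N -> w k.+1 = w k / (a k)%:R.
Proof. by case: k. Qed.

Lemma width_gt0 k : 0 < w k.
Proof.
elim: k => // -[|k] IH; first by rewrite /= ltr01.
by rewrite widthS // divr_gt0 // ltr0n a_gt0.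
Qed.

Lemma width_decr k : w k.+1 <= w k.
Proof.
case: k => [|k]; first by [].
rewrite widthS // ler_pdivrMr ?ltr0n ?a_gt0 //.
by rewrite ler_peMr ?ler1n ?a_gt0 // ltW // width_gt0.
Qed.

Lemma width_le m n : (m <= n)%N -> w n <= w m.
Proof.
elim: n => [|n IH]; first by rewrite leqn0 => /eqP ->.
rewrite leq_eqVlt => /predU1P[-> //|/IH]; exact/le_trans/width_decr.
Qed.

(** Every index with at least two cuts halves the width. *)
Lemma width_small :
  (forall N, exists k, [/\ (N <= k)%N, (0 < k)%N & (1 < a k)%N]) ->
  forall e : R, 0 < e -> exists N, forall k, (N <= k)%N -> w k < e.
Proof.
move=> a2 e e0.
have h n : exists k, w k <= (2 ^+ n)^-1.
  elim: n => [|n [k IH]]; first by exists 0%N; rewrite expr0 invr1.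
  have [l [kl l0 al]] := a2 k; exists l.+1.
  rewrite widthS // exprS invfM mulrC ler_pM ?invr_ge0 // ?(ltW (width_gt0 _)) //.
  - by rewrite lef_pV2 ?posrE ?ltr0n ?a_gt0 // ler_nat.
  - exact: le_trans (width_le kl) IH.
have [n hn] : exists n, (2 ^+ n)^-1 < e.
  exists (Num.truncn e^-1).+1; rewrite invf_plt ?posrE ?exprn_gt0 //.
  apply: (lt_trans (truncnS_gt _)).
  by rewrite -natrX ltr_nat ltn_expl.
have [N hN] := h n; exists N => k Nk.
by rewrite (le_lt_trans (width_le Nk)) // (le_lt_trans hN).
Qed.

Lemma cut_index_lt k n j : (0 < k)%N -> (n < q k)%N -> (j < a k)%N ->
  (j * q k + n < q k.+1)%N.
Proof. by move=> k0 nq ja; rewrite heightS //; nia. Qed.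

Lemma left_endS k N : (0 < k)%N -> le k.+1 N =
  if (N < a k * q k)%N then le k (N %% q k) + (N %/ q k)%:R * w k.+1
  else s k (N - a k * q k)%N.
Proof. by case: k. Qed.

Lemma left_end_cut k n j : (0 < k)%N -> (n < q k)%N -> (j < a k)%N ->
  le k.+1 (j * q k + n) = le k n + j%:R * w k.+1.
Proof.
move=> k0 nq ja; rewrite left_endS //.
have -> : (j * q k + n < a k * q k)%N by nia.
by rewrite modnMDl modn_small // divnMDl ?height_gt0 // divn_small // addn0.
Qed.

Lemma left_end_bottom k : le k 0 = 0.
Proof.
elim: k => // -[|k] IH //; rewrite -[0%N]/(0 * q k.+1 + 0)%N.
by rewrite left_end_cut ?height_gt0 ?a_gt0 // IH mul0r addr0.
Qed.

Lemma levelE k n x : lev k n x <-> le k n < x <= le k n + w k.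
Proof. by rewrite /level /= in_itv. Qed.

Lemma width_cut k : (0 < k)%N -> w k = (a k)%:R * w k.+1.
Proof.
by move=> k0; rewrite widthS // mulrC divfK // pnatr_eq0 -lt0n a_gt0.
Qed.

Lemma cut_sub_level k n j : (0 < k)%N -> (n < q k)%N -> (j < a k)%N ->
  lev k.+1 (j * q k + n) `<=` lev k n.
Proof.
move=> k0 nq ja x /levelE; rewrite left_end_cut // => /andP[h1 h2].
apply/levelE; rewrite (width_cut k0).
have w0 := width_gt0 k.+1.
have : 0 <= j%:R * w k.+1 by rewrite mulr_ge0 // ltW.
have : j.+1%:R * w k.+1 <= (a k)%:R * w k.+1 by rewrite ler_pM2r // ler_nat.
by rewrite -natr1 mulrDl mul1r => ? ?; apply/andP; split; lra.
Qed.

Lemma level_cut k n x : (0 < k)%N -> (n < q k)%N -> lev k n x ->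
  exists2 j, (j < a k)%N & lev k.+1 (j * q k + n) x.
Proof.
move=> k0 nq /levelE; rewrite (width_cut k0) => /andP[h1 h2].
have w0 := width_gt0 k.+1.
(* the piece of x is the first one whose right end is not below x *)
pose P j := x <= le k n + j.+1%:R * w k.+1.
have exP : exists j, P j.
  by exists (a k).-1; rewrite /P prednK ?a_gt0.
have [j Pj min] := ex_minnP exP.
have ja : (j < a k)%N.
  by have := min (a k).-1; rewrite /P prednK ?a_gt0 // => /(_ h2); have := a_gt0 k0; lia.
exists j => //; apply/levelE; rewrite left_end_cut //.
move: Pj; rewrite /P -natr1 mulrDl mul1r addrA => ->; rewrite andbT.
case: j min ja => [|j] min _; first by rewrite mul0r addr0.
rewrite ltNge; apply/negP => /min; lia.
Qed.

Lemma level_sub_column k n : (n < q k)%N -> lev k n `<=` col k.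
Proof. by move=> nq x h; exists n. Qed.

Lemma column_sub_succ k : col k `<=` col k.+1.
Proof.
case: k => [|k] x; first by case.
move=> [n nq h]; have [j ja h'] := level_cut (ltn0Sn k) nq h.
by exists (j * q k.+1 + n)%N => //; exact: cut_index_lt.
Qed.

Lemma column_le m n : (m <= n)%N -> col m `<=` col n.
Proof.
elim: n => [|n IH]; first by rewrite leqn0 => /eqP ->.
rewrite leq_eqVlt => /predU1P[-> //|/IH h].
exact: subset_trans h (@column_sub_succ n).
Qed.

(* level_index in column k.+1 is either a cut of k or a spacer *)
(** A level of column k+1 is either a piece of a level of column k or a
    spacer. *)
Lemma index_split k N : (0 < k)%N -> (N < q k.+1)%N ->
  (exists n j, [/\ (n < q k)%N, (j < a k)%N & N = (j * q k + n)%N]) \/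
  (exists2 i, (i < q k.-1)%N & N = (a k * q k + i)%N).
Proof.
move=> k0; rewrite heightS // => h.
have [lt|ge] := ltnP N (a k * q k)%N.
  left; exists (N %% q k)%N, (N %/ q k)%N; rewrite ltn_mod height_gt0 //.
  by rewrite ltn_divLR ?height_gt0 // -divn_eq.
by right; exists (N - a k * q k)%N; lia.
Qed.

(** Levels of one column are disjoint: pieces of distinct levels by induction,
    pieces of one level by their position, and spacers by hypothesis. *)
Lemma level_inj k m n x : (m < q k)%N -> (n < q k)%N ->
  lev k m x -> lev k n x -> m = n.
Proof.
elim: k m n x => // -[|k] IH m n x; first by case: m => //; case: n.
move=> mq nq; have k0 : (0 < k.+1)%N by [].
have [triv disj] := s_valid k0.
have [[m' [i [m'q ia ->]]]|[i ip ->]] := index_split k0 mq;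
have [[n' [j [n'q ja ->]]]|[j jp ->]] := index_split k0 nq.
- move=> hm hn; have E : m' = n'.
    by apply: (IH _ _ x) => //; [exact: cut_sub_level hm|exact: cut_sub_level hn].
  rewrite {}E in m'q hm *; congr (_ * _ + _)%N; apply/eqP.
  move: hm hn => /levelE; rewrite left_end_cut // => /andP[h1 h2] /levelE.
  rewrite left_end_cut // => /andP[h3 h4].
  have w0 := width_gt0 k.+2.
  have A : i%:R * w k.+2 < (j%:R + 1) * w k.+2 by rewrite mulrDl mul1r; lra.
  have B : j%:R * w k.+2 < (i%:R + 1) * w k.+2 by rewrite mulrDl mul1r; lra.
  by move: A B; rewrite !ltr_pM2r // !natr1 !ltr_nat; lia.
- move=> hm hn; have : (spacer a s k.+1 j `&` col k.+1) x.
    by split => //; exists m' => //; exact: cut_sub_level hm.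
  by rewrite disj.
- move=> hm hn; have : (spacer a s k.+1 i `&` col k.+1) x.
    by split => //; exists n' => //; exact: cut_sub_level hn.
  by rewrite disj.
- move=> hm hn; congr addn; apply: (triv i j) => //.
  by exists x; split.
Qed.

(* level_index of the level of column k containing x *)
(** The address of x in column k; 0 when x is not in the column. *)
Definition level_index k x : nat := xget 0%N [set n | (n < q k)%N /\ lev k n x].

Lemma level_indexP k x : col k x -> (level_index k x < q k)%N /\ lev k (level_index k x) x.
Proof. by move=> [n /= nq h]; rewrite /level_index; case: xgetP => [m -> //|/(_ n)[]]. Qed.

Lemma level_index_unique k n x : (n < q k)%N -> lev k n x -> level_index k x = n.
Proof.
move=> nq h; have [iq hi] := level_indexP (level_sub_column nq h).
exact: level_inj hi h.
Qed.

Lemma level_index_succ k x : (0 < k)%N -> col k x ->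
  exists2 j, (j < a k)%N & level_index k.+1 x = (j * q k + level_index k x)%N.
Proof.
move=> k0 /level_indexP[nq h]; have [j ja h'] := level_cut k0 nq h.
by exists j => //; apply: level_index_unique => //; exact: cut_index_lt.
Qed.

(** The translation from a level to the next one is inherited by the pieces in
    all later columns; so the definition of the tower map is consistent. *)
Lemma nontop_lift k K i x : (k <= K)%N -> (i.+1 < q k)%N -> lev k i x ->
  exists i', [/\ (i'.+1 < q K)%N, lev K i' x &
    le K i'.+1 - le K i' = le k i.+1 - le k i].
Proof.
move=> kK iq h; have k0 : (0 < k)%N by case: k iq {kK h}.
have [n ->] : exists n, K = (k + n)%N by exists (K - k)%N; lia.
elim: n => [|n [i' [i'q h' E]]]; first by rewrite addn0; exists i.
have l0 : (0 < k + n)%N by lia.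
have [j ja hj] := level_cut l0 (ltnW i'q) h'.
exists (j * q (k + n) + i')%N; rewrite (addnS k n).
have -> : (j * q (k + n) + i').+1 = (j * q (k + n) + i'.+1)%N by rewrite addnS.
split => //; first exact: cut_index_lt.
rewrite !left_end_cut //; [rewrite -E; ring|exact: ltnW].
Qed.

Lemma tower_map_translation k i x : (i.+1 < q k)%N -> lev k i x ->
  tower_map a s x = x + (le k i.+1 - le k i).
Proof.
move=> iq h; rewrite /tower_map; case: xgetP => [y _ [l [j [jq hl ->]]]|]; last first.
  by move=> /(_ (x + (le k i.+1 - le k i))) []; exists k, i.
congr (x + _).
have [i' [i'q hi' <-]] := nontop_lift (leq_maxl k l) iq h.
have [j' [j'q hj' <-]] := nontop_lift (leq_maxr k l) jq hl.
by rewrite (level_inj (ltnW i'q) (ltnW j'q) hi' hj').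
Qed.

Lemma level_shift k i j x :
  lev k j (x + (le k j - le k i)) <-> lev k i x.
Proof. by split=> /levelE /andP[? ?]; apply/levelE/andP; split; lra. Qed.

Lemma tower_map_level k i x : (i.+1 < q k)%N -> lev k i x ->
  lev k i.+1 (tower_map a s x).
Proof.
by move=> iq h; rewrite (tower_map_translation iq h); apply/level_shift.
Qed.

(** For k >= 2 there is at least one spacer on top of column k, so no point of
    column k is in the top level of column k+1. *)
Lemma column_nontop k x : (1 < k)%N -> col k x ->
  exists2 i, (i.+1 < q k.+1)%N & lev k.+1 i x.
Proof.
move=> k1 [n nq h]; have k0 : (0 < k)%N by lia.
have [j ja h'] := level_cut k0 nq h.
exists (j * q k + n)%N => //; rewrite heightS //.
have := height_gt0 (_ : 0 < k.-1)%N; have nq' : (n < q k)%N by []; nia.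
Qed.

Lemma tower_space_nontop x : tower_space a s x ->
  exists2 k, (0 < k)%N & forall K, (k <= K)%N ->
    exists2 i, (i.+1 < q K)%N & lev K i x.
Proof.
move=> [k _ hk]; exists (maxn k 2).+1 => // K kK.
have [K' E] : exists K', K = K'.+1 by exists K.-1; lia.
rewrite E; apply: column_nontop; first lia.
by apply: (column_le _ hk); lia.
Qed.

Lemma tower_map_stable : set_fun (tower_space a s) (tower_space a s) (tower_map a s).
Proof.
move=> x /tower_space_nontop[k k0 /(_ _ (leqnn k))[i iq h]].
exists k => //; apply: (level_sub_column iq); exact: tower_map_level.
Qed.

Lemma measurable_level k n : measurable (lev k n).
Proof. exact: measurable_itv. Qed.

Lemma measurable_column k : measurable (col k).
Proof. by apply: bigcup_measurable => n _; exact: measurable_level. Qed.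

Lemma measurable_tower_space : measurable (tower_space a s).
Proof. by apply: bigcupT_measurable => k; exact: measurable_column. Qed.

(** The part of column k on which that column defines the tower map. *)
Definition nontops k : set R := \bigcup_(i in [set i | (i.+1 < q k)%N]) lev k i.
(** The image of [nontops] under the tower map. *)
Definition nonbottoms k : set R :=
  \bigcup_(i in [set i | (i.+1 < q k)%N]) lev k i.+1.

Lemma nontops_incr k : nontops k `<=` nontops k.+1.
Proof.
move=> x [i iq h]; have [i' [i'q h' _]] := nontop_lift (leqnSn k) iq h.
by exists i'.
Qed.

Lemma nonbottoms_incr k : nonbottoms k `<=` nonbottoms k.+1.
Proof.
move=> x [i iq h].
have h0 : lev k i (x + (le k i - le k i.+1)) by apply/level_shift.
have [i' [i'q h' E]] := nontop_lift (leqnSn k) iq h0.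
exists i' => //; have -> : x = (x + (le k i - le k i.+1)) + (le k.+1 i'.+1 - le k.+1 i').
  by rewrite E; ring.
by apply/level_shift.
Qed.

Lemma bigcup_nontops : \bigcup_k nontops k = tower_space a s.
Proof.
apply/seteqP; split => x.
  by move=> [k _ [i iq h]]; exists k => //; exact: (level_sub_column (ltnW iq)).
by move=> /tower_space_nontop[k k0 /(_ _ (leqnn k))[i iq h]]; exists k => //; exists i.
Qed.

Section ThinTower.
Hypothesis w_small : forall e : R, 0 < e -> exists N, forall k, (N <= k)%N -> w k < e.

(** The bottom level of column k is ]0, w_k]; its width tends to 0, so no
    point stays in the bottom levels. This makes the tower map onto. *)
Lemma bigcup_nonbottoms : \bigcup_k nonbottoms k = tower_space a s.
Proof.
apply/seteqP; split => x.
  by move=> [k _ [i iq h]]; exists k => //; exact: (level_sub_column iq).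
move=> /tower_space_nontop[k k0 h].
suff [K [kK]] : exists K, (k <= K)%N /\ ~ lev K 0 x.
  have [[|i] iq hi] := h K kK; first by [].
  by move=> _; exists K => //; exists i => //; exact: ltnW.
have [x0|x0] := ltP 0 x; last first.
  by exists k; split => // /levelE; rewrite left_end_bottom; lra.
have [N hN] := w_small x0; exists (maxn k N); split; first exact: leq_maxl.
move=> /levelE; rewrite left_end_bottom add0r => /andP[_].
by rewrite leNgt hN // leq_maxr.
Qed.

Lemma lebesgue_measure_shift (c : R) (A : set R) : measurable A ->
  lebesgue_measure ((fun x => x + c) @^-1` A) = lebesgue_measure A.
Proof.
move=> mA.
have mc : measurable_fun setT ((fun x => x + c) : measurableTypeR R -> measurableTypeR R).
  exact: measurable_funD.
transitivity (pushforward lebesgue_measure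
  ((fun x => x + c) : measurableTypeR R -> measurableTypeR R) A) => //.
apply/esym/lebesgue_measure_unique => //= _ [[u v]] _ <-.
rewrite /pushforward.
have -> : (fun x => x + c) @^-1` `]u, v]%classic = `]u - c, v - c]%classic.
  by apply/seteqP; split => x /=; rewrite !in_itv /= => /andP[? ?]; apply/andP; split; lra.
rewrite !lebesgue_measure_itv /= !lte_fin ltrD2r; case: ifP => // _.
by rewrite -!EFinD; congr (_%:E); ring.
Qed.

Lemma level_preimage k i (A : set R) : (i.+1 < q k)%N ->
  lev k i `&` tower_map a s @^-1` A =
  (fun x => x + (le k i.+1 - le k i)) @^-1` (lev k i.+1 `&` A).
Proof.
move=> iq; apply/seteqP; split => x /=.
  by move=> [h]; rewrite (tower_map_translation iq h) => ?; split => //; apply/level_shift.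
by move=> [/level_shift h]; rewrite (tower_map_translation iq h).
Qed.

Lemma nontops_preimage k (A : set R) :
  nontops k `&` tower_map a s @^-1` A =
  \bigcup_(i in [set i | (i.+1 < q k)%N]) (lev k i `&` tower_map a s @^-1` A).
Proof. by rewrite setI_bigcupl. Qed.

Lemma measurable_level_preimage k i (A : set R) : (i.+1 < q k)%N ->
  measurable A -> measurable (lev k i `&` tower_map a s @^-1` A).
Proof.
move=> iq mA; rewrite level_preimage // -[X in measurable X]setTI.
have : measurable_fun setT ((fun x => x + (le k i.+1 - le k i)) : measurableTypeR R -> measurableTypeR R).
  exact: measurable_funD.
by apply => //; apply: measurableI => //; exact: measurable_level.
Qed.

Lemma measurable_nontops_preimage k (A : set R) : measurable A ->
  measurable (nontops k `&` tower_map a s @^-1` A).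
Proof.
move=> mA; rewrite nontops_preimage; apply: bigcup_measurable => i iq.
exact: measurable_level_preimage.
Qed.

Lemma tower_space_preimage (A : set R) :
  tower_space a s `&` tower_map a s @^-1` A =
  \bigcup_k (nontops k `&` tower_map a s @^-1` A).
Proof. by rewrite -bigcup_nontops setI_bigcupl. Qed.

Lemma measurable_tower_map : measurable_fun (tower_space a s) (tower_map a s).
Proof.
move=> _ A mA; rewrite tower_space_preimage; apply: bigcupT_measurable => k.
exact: measurable_nontops_preimage.
Qed.

Lemma nontops_measure k (A : set R) : measurable A ->
  lebesgue_measure (nontops k `&` tower_map a s @^-1` A) =
  lebesgue_measure (nonbottoms k `&` A).
Proof.
move=> mA; rewrite nontops_preimage setI_bigcupl !measure_bigcup.
- apply: eq_eseriesr => i /set_mem iq; rewrite level_preimage //.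
  apply: lebesgue_measure_shift; apply: measurableI => //; exact: measurable_level.
- by move=> i _; apply: measurableI => //; exact: measurable_level.
- move=> i j iq jq [x [[hi _] [hj _]]]; apply/eq_add_S; exact: level_inj hi hj.
- by move=> i iq; exact: measurable_level_preimage.
- move=> i j iq jq [x [[hi _] [hj _]]].
  by apply: (level_inj _ _ hi hj); exact: ltnW.
Qed.

(** On the non-top levels of column k the tower map is a translation of each
    level, onto the non-bottom levels; both unions increase to X with k. *)
Lemma tower_map_measure (A : set R) : measurable A ->
  lebesgue_measure (tower_space a s `&` tower_map a s @^-1` A) =
  lebesgue_measure (tower_space a s `&` A).
Proof.
move=> mA.
pose F k := nontops k `&` tower_map a s @^-1` A.
pose G k := nonbottoms k `&` A.
have mF k : measurable (F k) by exact: measurable_nontops_preimage.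
have mG k : measurable (G k).
  apply: measurableI => //; apply: bigcup_measurable => i _; exact: measurable_level.
have cF : lebesgue_measure \o F @ \oo -->
    lebesgue_measure (tower_space a s `&` tower_map a s @^-1` A).
  rewrite tower_space_preimage; apply: nondecreasing_cvg_mu => //.
    exact: bigcupT_measurable.
  by apply/nondecreasing_seqP => k; apply/subsetPset; apply: setSI; exact: nontops_incr.
have cG : lebesgue_measure \o G @ \oo --> lebesgue_measure (tower_space a s `&` A).
  rewrite -bigcup_nonbottoms setI_bigcupl; apply: nondecreasing_cvg_mu => //.
    exact: bigcupT_measurable.
  by apply/nondecreasing_seqP => k; apply/subsetPset; apply: setSI; exact: nonbottoms_incr.
have FG : lebesgue_measure \o F = lebesgue_measure \o G.
  by apply/funext => k; exact: nontops_measure.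
rewrite FG in cF; exact: (cvg_unique _ cF cG).
Qed.

Lemma tower_map_measure_preserving :
  measure_preserving (tower_space a s) lebesgue_measure (tower_map a s).
Proof.
split; [exact: measurable_tower_space|exact: tower_map_stable|
        exact: measurable_tower_map|].
by move=> A mA AX; rewrite tower_map_measure // (setIidr AX).
Qed.

End ThinTower.
End Tower.

(** * Topology and Borel sets of the complex plane *)

Section ComplexTopology.
Context {R : realType}.
Local Notation C := (R[i]^o).
Implicit Types z w : R[i].

Lemma normcE z : `|z| = (normc z)%:C. Proof. by []. Qed.

Lemma normc_ge0 z : 0 <= normc z. Proof. by rewrite -lecR; exact: (@normr_ge0 R[i] R[i] z). Qed.

Lemma normc_le z : normc z <= `|Re z| + `|Im z|.
Proof.
case: z => x y /=; rewrite -[leRHS]ger0_norm ?addr_ge0 // -sqrtr_sqr.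
rewrite ler_wsqrtr // -(real_normK (num_real x)) -(real_normK (num_real y)).
have := normr_ge0 x; have := normr_ge0 y; nra.
Qed.

Lemma ler_Re_normc z : `|Re z| <= normc z.
Proof. by rewrite -lecR -normcE normc_ge_Re. Qed.

Lemma ler_Im_normc z : `|Im z| <= normc z.
Proof.
case: z => x y /=; rewrite -sqrtr_sqr ler_wsqrtr // lerDr sqr_ge0 //.
Qed.

Lemma normc_distC z w : normc (z - w) = normc (w - z).
Proof. by rewrite -normcN opprB. Qed.

Lemma normc_triangle v z w : normc (z - w) <= normc (z - v) + normc (v - w).
Proof. by rewrite -lecR rmorphD; exact: (@ler_distD R[i] R[i] v z w). Qed.

(** The topology of the complex numbers has complex radii; the next lemmas
    express it with the real-valued modulus. *)
Lemma complex_ball z (e : R) w : ball (z : C) e%:C (w : C) <-> normc (z - w) < e.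
Proof.
rewrite -ball_normE /= /ball_ /=. by rewrite normcE ltcR; split.
Qed.

Lemma pos_complex (e : R[i]) : 0 < e -> exists2 r : R, 0 < r & e = r%:C.
Proof.
case: e => x y; rewrite ltcE /= => /andP[/eqP -> x0]; by exists x.
Qed.

Lemma cvg_complex (u : nat -> R[i]) z :
  (forall e : R, 0 < e -> exists N, forall n, (N <= n)%N -> normc (z - u n) < e) ->
  (u : nat -> C) @ \oo --> (z : C).
Proof.
move=> h; apply/cvg_ballP => _ /pos_complex[e e0 ->].
have [N hN] := h e e0; exists N => // n Nn; apply/complex_ball; exact: hN.
Qed.

Lemma cvg_complexP (u : nat -> R[i]) z : (u : nat -> C) @ \oo --> (z : C) ->
  forall e : R, 0 < e -> exists N, forall n, (N <= n)%N -> normc (z - u n) < e.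
Proof.
move=> /cvg_ballP h e e0; have e0' : (0 : R[i]) < e%:C by rewrite ltcR.
by have [N _ hN] := h _ e0'; exists N => n Nn; apply/complex_ball/hN.
Qed.

Lemma cauchy_real (x : nat -> R) :
  (forall e : R, 0 < e -> exists N, forall m n, (N <= m)%N -> (N <= n)%N ->
     `|x m - x n| < e) -> cvg (x @ \oo).
Proof.
move=> h; apply/cauchy_cvgP/cauchy_ballP => e e0.
have [N hN] := h e e0; exists (x @` [set n | (N <= n)%N], x @` [set n | (N <= n)%N]).
  by split; exists N => // n; exists n.
by move=> [_ _] [[m Nm <-] [n Nn <-]]; rewrite /= -ball_normE /=; exact: hN.
Qed.

(** Completeness of the real line, applied to real and imaginary parts. *)
Lemma cauchy_complex (u : nat -> R[i]) :
  (forall e : R, 0 < e -> exists N, forall m n, (N <= m)%N -> (N <= n)%N ->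
     normc (u m - u n) < e) -> cvg ((u : nat -> C) @ \oo).
Proof.
move=> h.
have cR : cvg ((fun n => Re (u n)) @ \oo).
  apply: cauchy_real => e e0; have [N hN] := h e e0; exists N => m n Nm Nn.
  rewrite -raddfB; exact: le_lt_trans (ler_Re_normc _) (hN _ _ Nm Nn).
have cI : cvg ((fun n => Im (u n)) @ \oo).
  apply: cauchy_real => e e0; have [N hN] := h e e0; exists N => m n Nm Nn.
  rewrite -raddfB; exact: le_lt_trans (ler_Im_normc _) (hN _ _ Nm Nn).
move: cR cI => /cvg_ex[x /cvgrPdist_lt cx] /cvg_ex[y /cvgrPdist_lt cy].
apply/cvg_ex; exists (x +i* y).
apply: cvg_complex => e e0; have e20 : 0 < e / 2 by lra.
have [N _ hN] := cx _ e20; have [M _ hM] := cy _ e20.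
exists (maxn N M) => n; rewrite geq_max => /andP[Nn Mn].
apply: (le_lt_trans (normc_le _)).
have := hN n Nn; have := hM n Mn; case: (u n) => x' y' /=; lra.
Qed.

Lemma open_complex (U : set C) z : open U -> U z ->
  exists2 r : R, 0 < r & forall w, normc (z - w) < r -> U w.
Proof.
move=> oU Uz; have /nbhs_ballP[_ /pos_complex[r r0 ->] hr] := open_nbhs_nbhs (conj oU Uz).
by exists r => // w hw; apply: hr; apply/complex_ball.
Qed.

Lemma closure_complex (A : set C) z : closure A z ->
  forall e : R, 0 < e -> exists2 w, A w & normc (z - w) < e.
Proof.
move=> cA e e0; have : nbhs (z : C) (ball (z : C) e%:C).
  by apply: nbhsx_ballx; rewrite ltcR.
by move=> /cA[w [Aw /complex_ball hw]]; exists w.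
Qed.

Lemma open_borelC (U : set C) : open U -> measurable (U : set (borelC R)).
Proof. by move=> oU; apply: sub_sigma_algebra. Qed.

Lemma closed_borelC (U : set C) : closed U -> measurable (U : set (borelC R)).
Proof.
move=> cU; rewrite -(setCK U); apply: measurableC; apply: open_borelC.
by rewrite openC.
Qed.

Lemma complex_hausdorff : hausdorff_space C.
Proof. exact: norm_hausdorff. Qed.

Lemma borelC_set1 z : measurable ([set z] : set (borelC R)).
Proof.
apply: closed_borelC; apply: accessible_closed_set1.
exact: hausdorff_accessible complex_hausdorff.
Qed.

End ComplexTopology.

(** * The exponential map of the circle *)

Arguments normc : simpl never.

Section Turn.
Context {R : realType}.
Local Notation C := (R[i]^o).
Implicit Types s t : R.

(** The exponential t |-> e^(2 pi i t), of period 1. *)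
Definition turn t : R[i] := expi (2 * pi * t).

Lemma expiD s t : expi (s + t) = expi s * expi t.
Proof.
rewrite /expi sinD cosD; apply/eqP; rewrite eq_complex /=.
by apply/andP; split; apply/eqP; ring.
Qed.

Lemma expi0 : expi 0 = 1 :> R[i].
Proof. by rewrite /expi sin0 cos0. Qed.

Lemma turnD s t : turn (s + t) = turn s * turn t.
Proof. by rewrite /turn mulrDr expiD. Qed.

Lemma turn0 : turn 0 = 1.
Proof. by rewrite /turn mulr0 expi0. Qed.

Lemma turn1 : turn 1 = 1.
Proof.
by rewrite /turn mulr1 /expi (mulr_natl (pi : R) 2) cos2pi sin2pi.
Qed.

Lemma turnM t n : turn (n%:R * t) = turn t ^+ n.
Proof.
elim: n => [|n IH]; first by rewrite mul0r turn0.
by rewrite -natr1 mulrDl mul1r turnD IH exprSr.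
Qed.

Lemma normc_turn t : normc (turn t) = 1.
Proof. by rewrite /normc /turn /expi cos2Dsin2 sqrtr1. Qed.

Lemma turnN t : turn t * turn (- t) = 1.
Proof. by rewrite -turnD subrr turn0. Qed.

Lemma turn_int (p : int) : turn p%:~R = 1.
Proof.
have h (n : nat) : turn n%:R = 1 by rewrite -[n%:R]mulr1 turnM turn1 expr1n.
case: p => n; first exact: h.
by rewrite NegzE mulrNz -[LHS]mul1r -[X in X * _](h n.+1) turnN.
Qed.

(** Rotating both points so that the second one becomes 1 reduces a chord to
    one starting at 1. *)
Lemma turn_chord s t (p : int) :
  normc (turn s - turn t) = normc (turn (s - t - p%:~R) - 1).
Proof.
have -> : turn s - turn t = turn t * (turn (s - t) - 1).
  by rewrite mulrBr -turnD mulr1; congr (turn _ - _); ring.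
rewrite normcM normc_turn mul1r; congr normc; congr (_ - _).
by rewrite -{1}(subrK p%:~R (s - t)) [LHS]turnD turn_int mulr1.
Qed.

(** Continuity of the exponential at 0, transported to all points and all
    integer shifts. *)
Lemma turn_near (e : R) : 0 < e -> exists2 d : R, 0 < d &
  forall s t (p : int), `|s - t - p%:~R| < d -> normc (turn s - turn t) < e.
Proof.
move=> e0; have e20 : 0 < e / 2 by lra.
have cc : {for 0, continuous (fun x : R => cos (2 * pi * x))}.
  apply: (@continuous_comp _ _ _ (fun x : R => 2 * pi * x) cos).
    exact: mulrl_continuous.
  exact: continuous_cos.
have cs : {for 0, continuous (fun x : R => sin (2 * pi * x))}.
  apply: (@continuous_comp _ _ _ (fun x : R => 2 * pi * x) sin).
    exact: mulrl_continuous.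
  exact: continuous_sin.
move: cc cs => /cvgrPdist_lt /(_ _ e20) /nbhs_ballP[d1 /= d10 h1].
move=> /cvgrPdist_lt /(_ _ e20) /nbhs_ballP[d2 /= d20 h2].
exists (Num.min d1 d2); first by rewrite lt_min d10 d20.
move=> s t p; rewrite (turn_chord s t p) lt_min => /andP[hd1 hd2].
set x := s - t - _ in hd1 hd2 *.
have := h1 x; have := h2 x; rewrite -ball_normE /= mulr0 sin0 cos0 !sub0r !normrN.
move=> /(_ hd2) k2 /(_ hd1) k1.
apply: le_lt_trans (normc_le _) _; rewrite /= subr0 distrC; lra.
Qed.

(** With r in [e, 1 - e] the fractional part of s - t, the real part of
    e^(2 pi i r) - 1 is at most cos (2 pi e) - 1, by monotonicity of the
    cosine on [0, pi] after the symmetry r |-> 1 - r. *)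
Lemma turn_far (e : R) : 0 < e -> exists2 c : R, 0 < c &
  forall s t, (forall p : int, e <= `|s - t - p%:~R|) ->
    c <= normc (turn s - turn t).
Proof.
move=> e0.
have [e1|e1] := ltP (2^-1) e.
  exists 1 => // s t h; exfalso.
  have := h (Num.floor (s - t)); have := h (Num.floor (s - t) + 1).
  have /andP[] := floor_itv (s - t); rewrite intrD.
  set f := (Num.floor _)%:~R => f1 f2; rewrite ler0_norm ?ger0_norm; lra.
have pi0 : 0 < (pi : R) by exact: pi_gt0.
exists (1 - cos (2 * pi * e)).
  rewrite subr_gt0 -[ltRHS](cos0 R) ltr_cos ?in_itv /=; last 2 first.
  - by rewrite lexx ltW.
  - by apply/andP; split; [rewrite !mulr_ge0 // ltW|nra].
  by rewrite !mulr_gt0.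
move=> s t h; rewrite (turn_chord s t (Num.floor (s - t))).
set r := s - t - _.
have r1 : e <= r.
  have := h (Num.floor (s - t)); rewrite ger0_norm // subr_ge0.
  by have /andP[] := floor_itv (s - t).
have r2 : r <= 1 - e.
  have := h (Num.floor (s - t) + 1); rewrite ler0_norm.
    by rewrite intrD /r; lra.
  by rewrite subr_le0 ltW //; have /andP[] := floor_itv (s - t).
apply: le_trans (ler_Re_normc _); rewrite distrC /=.
apply: le_trans (ler_norm _); rewrite lerD2l lerN2.
wlog r3 : r r1 r2 / r <= 2^-1 => [hw|].
  have [|r3] := leP r 2^-1; first exact: hw.
  have -> : cos (2 * pi * r) = cos (2 * pi * (1 - r)).
    rewrite -[RHS]cosN -[RHS]cosD2pi; congr cos.
    by rewrite -(mulr_natl (pi : R) 2); ring.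
  by apply: hw; lra.
have hI x : e <= x -> x <= 2^-1 -> 2 * pi * x \in `[0, pi].
  move=> x1 x2; rewrite in_itv /=; apply/andP; split; last nra.
  by rewrite !mulr_ge0 //; lra.
rewrite leNgt ltr_cos ?hI // -leNgt; nra.
Qed.

Lemma turn_inj s t : turn s = turn t -> exists p : int, s - t = p%:~R.
Proof.
move=> st; apply: contrapT => np.
pose r := s - t - (Num.floor (s - t))%:~R.
have /andP[f1 f2] := floor_itv (s - t).
have r0 : 0 < r.
  rewrite subr_gt0 lt_neqAle f1 andbT; apply/eqP => E.
  by apply: np; exists (Num.floor (s - t)).
have r1 : r < 1 by rewrite ltrBlDl -intrD1.
have [c c0 hc] := @turn_far (Num.min r (1 - r)) ltac:(by rewrite lt_min r0 subr_gt0).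
suff : c <= normc (turn s - turn t) by rewrite st subrr normc0 leNgt c0.
apply: hc => p; rewrite ge_min.
have [pf|pf] := leP p (Num.floor (s - t)).
  apply/orP; left; rewrite ler_normr; apply/orP; left.
  by rewrite lerD2l lerN2 ler_int.
apply/orP; right; rewrite ler_normr; apply/orP; right.
have : (Num.floor (s - t) + 1)%:~R <= p%:~R :> R by rewrite ler_int lezD1.
rewrite intrD /r; lra.
Qed.

Lemma turn_surj (z : R[i]) : normc z = 1 -> exists2 t, 0 <= t < 1 & z = turn t.
Proof.
case: z => x y; rewrite /normc => h; have pi0 : 0 < (pi : R) by exact: pi_gt0.
have xy : x ^+ 2 + y ^+ 2 = 1.
  by rewrite -[LHS]sqr_sqrtr ?addr_ge0 ?sqr_ge0 // h expr1n.
have x1 : -1 <= x <= 1 by apply/andP; split; nra.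
have [/andP[a1 a2] a3] := acos_def x1.
have sa : sin (acos x) = `|y|.
  by rewrite sin_acos // -xy addrAC subrr add0r sqrtr_sqr.
have E (t : R) : 2 * pi * (t / (2 * pi)) = t.
  by rewrite mulrC divfK // gt_eqF // mulr_gt0.
have [y0|y0] := leP 0 y.
  exists (acos x / (2 * pi)).
    apply/andP; split; first by rewrite divr_ge0 // mulr_ge0 // ltW.
    rewrite ltr_pdivrMr ?mulr_gt0 //; lra.
  by rewrite /turn E /expi a3 sa ger0_norm.
exists ((pi *+ 2 - acos x) / (2 * pi)).
  apply/andP; split.
    by rewrite divr_ge0 ?mulr_ge0 //; [rewrite mulr2n; lra|lra].
  rewrite ltr_pdivrMr ?mulr_gt0 // -(mulr_natl (pi : R) 2) mul1r ltrBlDr ltrDl.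
  rewrite lt_neqAle a1 andbT; apply/eqP => E0.
  by move: sa; rewrite -E0 sin0 => /esym/eqP; rewrite normr_eq0 => /eqP y00; lra.
rewrite /turn E /expi addrC cosD2pi sinD2pi cosN sinN a3 sa ltr0_norm //.
by rewrite opprK.
Qed.

Lemma continuous_turn : continuous (turn : R -> C).
Proof.
move=> x; apply/cvg_ballP => _ /pos_complex[e e0 ->].
have [d d0 hd] := turn_near e0.
near=> t; apply/complex_ball; apply: (hd _ _ 0); rewrite subr0.
near: t; apply/nbhs_ballP; exists d => //= t.
Unshelve. all: by end_near. Qed.

Lemma measurable_turn : measurable_fun setT (turn : R -> borelC R).
Proof.
apply: measurability => //= _ [U oU <-].
by rewrite setTI; apply: open_measurable; apply: open_comp => // x _; exact: continuous_turn.
Qed.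

End Turn.

(** * The eigenfunction *)

Section EigenfunctionTheory.
Context {R : realType} (alpha : R) (s : nat -> nat -> R).
Hypothesis alpha_irr : irrational alpha.
Hypothesis s_valid : valid_spacers (cuts alpha) s.

Local Notation a := (cuts alpha).
Local Notation q := (height a).
Local Notation lev := (level a s).
Local Notation col := (column a s).
Local Notation X := (tower_space a s).
Local Notation T := (tower_map a s).
Local Notation f := (eigenfunction alpha s : R -> R[i]).
Local Notation idx := (level_index a s).
Local Notation C := (R[i]^o).

Let a_gt0 := cuts_gt0 alpha_irr.

Definition phase n : R[i] := turn (n%:R * alpha).

Lemma eigen_g_level k n x : (n < q k)%N -> lev k n x ->
  eigen_g alpha s k x = phase n.
Proof.
move=> nq h; rewrite /eigen_g (bigD1 (Ordinal nq)) //= big1 ?addr0.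
  by rewrite indicE mem_set // mulr1 /phase turnM.
move=> i /eqP ni; rewrite indicE memNset ?mulr0 // => hi; apply: ni.
by apply: val_inj => /=; exact: level_inj hi h.
Qed.

Lemma eigen_approx_index k x : col k x ->
  eigen_approx alpha s k x = phase (idx k x).
Proof.
move=> h; rewrite /eigen_approx mem_set //.
by have [iq hi] := level_indexP h; exact: eigen_g_level.
Qed.

Lemma column_gt0 k x : col k x -> (0 < k)%N.
Proof. by case: k => // -[]. Qed.

Lemma index_digits k x : col k x -> digits alpha k (idx ^~ x).
Proof.
move=> h j kj; apply: (level_index_succ a_gt0 s_valid).
  exact: leq_trans (column_gt0 h) kj.
exact: column_le h.
Qed.

Lemma const_digits k n : (0 < k)%N -> digits alpha k (fun=> n).
Proof. by move=> k0 j kj; exists 0%N => //; apply: a_gt0; lia. Qed.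

(** Compares the itinerary of x with the one all of whose digits from k on are
    0, for which the address is constant. *)
Lemma index_near k K x : (k <= K)%N -> col k x ->
  exists p : int, `|(idx K x)%:R * alpha - (idx k x)%:R * alpha - p%:~R| <=
    gap alpha k.-1.
Proof.
move=> kK h; have k0 := column_gt0 h.
have [|//|p hp] := digits_near alpha_irr (_ : 0 < k <= K)%N (index_digits h)
  (const_digits (idx k x) k0) _; first by rewrite k0.
by exists p; rewrite -mulrBl.
Qed.

Lemma index_separated k K x y : (k <= K)%N -> col k x -> col k y ->
  idx k x != idx k y -> forall p : int,
  gap alpha k.+1 <= `|(idx K x)%:R * alpha - (idx K y)%:R * alpha - p%:~R|.
Proof.
move=> kK hx hy xy p; rewrite -mulrBl.
apply: (digits_separated alpha_irr _ (index_digits hx) (index_digits hy)) => //.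
- by rewrite (column_gt0 hx).
- by case: (level_indexP hx).
- by case: (level_indexP hy).
Qed.

(** The approximants g_k form a uniform Cauchy sequence, because gap k tends
    to 0. *)
Lemma approx_uniform (e : R) : 0 < e -> exists2 N, (0 < N)%N &
  forall k K x, (N <= k <= K)%N -> col k x ->
    normc (phase (idx K x) - phase (idx k x)) < e.
Proof.
move=> e0; have [d d0 hd] := turn_near e0.
have [N hN] := gap_small alpha_irr d0; exists N.+1 => // k K x /andP[Nk kK] h.
have [p hp] := index_near kK h; apply: (hd _ _ p).
by apply: le_lt_trans hp _; apply: hN; lia.
Qed.

Lemma eigen_approx_cvg x : X x ->
  (fun k => eigen_approx alpha s k x : C) @ \oo --> (f x : C).
Proof.
move=> [k0 _ h0]; apply: cauchy_complex => e e0.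
have e20 : 0 < e / 2 by lra.
have [N N0 hN] := approx_uniform e20; pose M := maxn N k0.
exists M => m n Mm Mn.
have hM : col M x by exact: (column_le _ (leq_maxr _ _)) h0.
rewrite !eigen_approx_index; try by exact: (column_le _ _ hM).
apply: le_lt_trans (normc_triangle (phase (idx M x)) _ _) _.
by rewrite [e]splitr ltrD ?[ltLHS](normc_distC (phase (idx M x))) ?hN ?leq_maxl.
Qed.

Lemma normc_limit (u : nat -> R[i]) (z v : R[i]) (e : R) :
  (u : nat -> C) @ \oo --> (z : C) ->
  (exists N, forall n, (N <= n)%N -> normc (v - u n) <= e) -> normc (v - z) <= e.
Proof.
move=> /cvg_complexP cu [N hN]; apply/ler_addgt0Pr => d d0.
have [M hM] := cu d d0.
apply: le_trans (normc_triangle (u (maxn N M)) _ _) _.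
by rewrite lerD ?hN ?leq_maxl // normc_distC ltW // hM // leq_maxr.
Qed.

Lemma eigenfunction_near (e : R) : 0 < e -> exists2 N, (0 < N)%N &
  forall k x, (N <= k)%N -> col k x -> normc (phase (idx k x) - f x) <= e.
Proof.
move=> e0; have [N N0 hN] := approx_uniform e0; exists N => // k x Nk h.
have hX : X x by exists k.
apply: (normc_limit (eigen_approx_cvg hX)); exists k => n kn.
rewrite eigen_approx_index; last by exact: column_le h.
by rewrite normc_distC ltW // hN // Nk.
Qed.

(** The separation of [index_separated] does not depend on the later column K,
    so it survives in the limit as a lower bound on chords. *)
Lemma eigenfunction_separated k : exists2 c : R, 0 < c &
  forall x y, col k x -> col k y -> idx k x != idx k y -> c <= normc (f x - f y).
Proof.
have [c c0 hc] := turn_far (gap_gt0 alpha_irr k.+1); exists c => // x y hx hy xy.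
have hX : X x by exists k.
have hY : X y by exists k.
apply/ler_addgt0Pr => e e0; have e20 : 0 < e / 2 by lra.
have [N N0 hN] := eigenfunction_near e20; pose K := maxn N k.
have kK : (k <= K)%N by exact: leq_maxr.
have hx' : col K x by exact: column_le hx.
have hy' : col K y by exact: column_le hy.
have h1 := hN K x (leq_maxl _ _) hx'; have h2 := hN K y (leq_maxl _ _) hy'.
have h3 : c <= normc (phase (idx K x) - phase (idx K y)).
  by apply: hc => p; exact: index_separated.
have h4 := normc_triangle (f x) (phase (idx K x)) (phase (idx K y)).
have h5 := normc_triangle (f y) (f x) (phase (idx K y)).
rewrite (normc_distC (f y)) in h5; lra.
Qed.

Lemma eigenfunction_circle x : X x -> normc (f x) = 1.
Proof.
move=> [k hk h]; apply/eqP; rewrite eq_le; apply/andP.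
have n0 (z : R[i]) : normc (z - 0) = normc z by rewrite subr0.
split; apply/ler_addgt0Pr => e e0; have [N N0 hN] := eigenfunction_near e0;
  have hx : col (maxn N k) x by [exact: (column_le _ (leq_maxr _ _)) h];
  have h1 := hN _ _ (leq_maxl _ _) hx.
  have := normc_triangle (phase (idx (maxn N k) x)) (f x) 0.
  rewrite !n0 normc_distC normc_turn; lra.
have := normc_triangle (f x) (phase (idx (maxn N k) x)) 0.
rewrite !n0 normc_turn; lra.
Qed.

(** The tower map raises the address in all sufficiently late columns by 1. *)
Lemma eigenfunction_equivariant x : X x -> f (T x) = turn alpha * f x.
Proof.
move=> hX; have [k k0 hk] := tower_space_nontop a_gt0 hX.
have c1 := eigen_approx_cvg (tower_map_stable a_gt0 s_valid hX).
apply/eqP; rewrite -subr_eq0; apply/eqP/eq0_normc/eqP.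
rewrite eq_le normc_ge0 andbT; apply/ler_addgt0Pr => e e0; rewrite add0r.
rewrite normc_distC; apply: (normc_limit c1).
have [N hN] := cvg_complexP (eigen_approx_cvg hX) e0.
exists (maxn N k) => n; rewrite geq_max => /andP[Nn kn].
have [i iq hi] := hk n kn.
have := hN n Nn; rewrite !eigen_approx_index.
- have -> : idx n x = i by apply: level_index_unique => //; exact: ltnW.
  have -> : idx n (T x) = i.+1.
    by apply: level_index_unique => //; exact: tower_map_level.
  rewrite /phase -natr1 mulrDl mul1r [turn (_ + _)]turnD [_ * turn alpha]mulrC -mulrBr.
  by rewrite normcM normc_turn mul1r => /ltW.
- exact: level_sub_column (tower_map_level a_gt0 s_valid iq hi).
- exact: level_sub_column (ltnW iq) _ hi.
Qed.

Section NotGolden.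
Hypothesis alpha_ngold : ~ golden_type alpha.

Let w_small := @width_small R a a_gt0 (cuts_ge2 alpha_irr alpha_ngold).

(** Once the width is below |x - y|, no level contains both points. *)
Lemma index_distinguishes x y : x != y -> exists N, forall k, (N <= k)%N ->
  col k x -> col k y -> idx k x != idx k y.
Proof.
move=> xy; have d0 : 0 < `|x - y| by rewrite normr_gt0 subr_eq0.
have [N hN] := w_small d0; exists N => k Nk /level_indexP[_ /levelE h1] /level_indexP[_ /levelE h2].
apply/eqP => E; rewrite E in h1.
have := hN k Nk; case/andP: h1 => ? ?; case/andP: h2 => ? ?.
by rewrite ltNge => /negP; apply; rewrite ler_norml; apply/andP; split; lra.
Qed.

Lemma eigenfunction_inj x y : X x -> X y -> f x = f y -> x = y.
Proof.
move=> [k _ hx] [l _ hy] fxy; apply/eqP/negP => /negP xy.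
have [N hN] := index_distinguishes xy; pose K := maxn N (maxn k l).
have hx' : col K x by apply: (column_le a_gt0 _ hx); rewrite /K; lia.
have hy' : col K y by apply: (column_le a_gt0 _ hy); rewrite /K; lia.
have [c c0 hc] := eigenfunction_separated K.
have := hc x y hx' hy' (hN K (leq_maxl _ _) hx' hy').
by rewrite fxy subrr normc0 leNgt c0.
Qed.

Lemma level_diameter (e : R) : 0 < e -> exists2 N, (0 < N)%N &
  forall k n x y, (N <= k)%N -> (n < q k)%N -> lev k n x -> lev k n y ->
    normc (f x - f y) < e.
Proof.
move=> e0; have e30 : 0 < e / 3 by lra.
have [N N0 hN] := eigenfunction_near e30; exists N => // k n x y Nk nq hx hy.
have h1 := hN k x Nk (level_sub_column nq hx).
have h2 := hN k y Nk (level_sub_column nq hy).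
rewrite (level_index_unique a_gt0 s_valid nq hx) in h1.
rewrite (level_index_unique a_gt0 s_valid nq hy) in h2.
have := normc_triangle (phase n) (f x) (f y); rewrite (normc_distC (f x) (phase n)); lra.
Qed.

(** The preimage of an open set is the union of the levels that it contains,
    since the images of the levels shrink. *)
Lemma eigenfunction_measurable : measurable_fun X (eigenfunction alpha s).
Proof.
apply: measurability => //= _ [U oU <-].
suff -> : X `&` eigenfunction alpha s @^-1` U =
    \bigcup_k \bigcup_(n in [set n | (n < q k)%N /\ lev k n `<=` f @^-1` U]) lev k n.
  by apply: bigcupT_measurable => k; apply: bigcup_measurable => n _; exact: measurable_level.
apply/seteqP; split => x; last first.
  by move=> [k _ [n [nq sub] h]]; split; [exists k => //; exists n|exact: sub].
move=> [[k _ h] Ux]; have [r r0 hr] := open_complex oU Ux.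
have [N N0 hN] := level_diameter r0; pose K := maxn N k.
have [iq hi] := level_indexP (column_le a_gt0 (leq_maxr N k) h).
exists K => //; exists (idx K x) => //; split => // y hy.
by apply: hr; apply: (hN K (idx K x)) => //; exact: leq_maxl.
Qed.

Definition level_closure k n : set C := closure ((f : R -> C) @` lev k n).

Lemma level_closure_inj k m n z : (m < q k)%N -> (n < q k)%N ->
  level_closure k m z -> level_closure k n z -> m = n.
Proof.
move=> mq nq hm hn; apply/eqP/negP => /negP mn.
have [c c0 hc] := eigenfunction_separated k; have c20 : 0 < c / 2 by lra.
have [_ [x hx <-] h1] := closure_complex hm c20.
have [_ [y hy <-] h2] := closure_complex hn c20.
have : c <= normc (f x - f y).
  apply: hc; [exact: level_sub_column hx|exact: level_sub_column hy|].
  by rewrite (level_index_unique a_gt0 s_valid mq hx)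
             (level_index_unique a_gt0 s_valid nq hy).
have := normc_triangle z (f x) (f y); rewrite (normc_distC (f x) z); lra.
Qed.

Lemma level_closure_near (e : R) : 0 < e -> exists2 N, (0 < N)%N &
  forall k n z, (N <= k)%N -> (n < q k)%N -> level_closure k n z ->
    normc (phase n - z) < e.
Proof.
move=> e0; have e20 : 0 < e / 2 by lra.
have [N N0 hN] := eigenfunction_near e20; exists N => // k n z Nk nq hz.
have [_ [x hx <-] h1] := closure_complex hz e20.
have := hN k x Nk (level_sub_column nq hx).
rewrite (level_index_unique a_gt0 s_valid nq hx).
have := normc_triangle (f x) (phase n) z; rewrite (normc_distC (f x) z); lra.
Qed.

(** The points that, for every column from k on, lie in the closure of the
    image of some level inside level n of column k: a Borel set which agrees
    with the image of that level up to a countable set. *)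
Definition level_trap k n : set C :=
  \bigcap_(j in [set j | (k <= j)%N])
    \bigcup_(m in [set m | (m < q j)%N /\ lev j m `<=` lev k n]) level_closure j m.

Lemma level_trap_measurable k n : measurable (level_trap k n : set (borelC R)).
Proof.
apply: bigcap_measurable; first by exists k => /=.
move=> j _; apply: bigcup_measurable => m _.
by apply: closed_borelC; exact: closed_closure.
Qed.

Lemma level_trap_image k n : (n < q k)%N -> f @` lev k n `<=` level_trap k n.
Proof.
move=> nq _ [x hx <-] j kj.
have k0 : (0 < k)%N by case: k nq {hx kj}.
suff [m [mq hm sub]] : exists m, [/\ (m < q j)%N, lev j m x & lev j m `<=` lev k n].
  by exists m => //; apply: subset_closure; exists x.
have -> : j = (k + (j - k))%N by rewrite subnKC.
elim: (j - k)%N => [|l [m [mq hm sub]]]; first by exists n; rewrite addn0; split.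
have l0 : (0 < k + l)%N by lia.
have [d da hd] := level_cut a_gt0 l0 mq hm.
exists (d * q (k + l) + m)%N; rewrite addnS; split => //.
  exact: cut_index_lt.
apply: subset_trans sub; exact: cut_sub_level.
Qed.

(** A trapped point z selects one level in each column from k on, as closures
    of the images of distinct levels are disjoint. The selected levels are
    nested half-open intervals and their left ends increase to a point x. If
    the left ends are never equal to x, then x lies in all selected levels and
    f x = z. Otherwise the selected address is eventually constant, and z is
    the power of lambda with this exponent. *)
Lemma level_trap_sub k n : (n < q k)%N ->
  level_trap k n `\` range phase `<=` f @` lev k n.
Proof.
move=> nq z [trap nphase].
have k0 : (0 < k)%N by case: k nq {trap}.
have [m hm] : exists m : nat -> nat, forall j, (k <= j)%N ->
    [/\ (m j < q j)%N, lev j (m j) `<=` lev k n & level_closure j (m j) z].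
  have : forall j, exists m, (k <= j)%N ->
      [/\ (m < q j)%N, lev j m `<=` lev k n & level_closure j m z].
    move=> j; have [kj|jk] := leqP k j; last by exists 0%N.
    by have [m [mq sub] hz] := trap j kj; exists m.
  by move=> /choice[m hm]; exists m.
(* left ends of the selected levels *)
pose L j := left_end a s j (m j).
(* the levels are nested *)
have step j : (k <= j)%N -> exists2 d, (d < a j)%N & m j.+1 = (d * q j + m j)%N.
  move=> kj; have j0 : (0 < j)%N by lia.
  have [mq sub hz] := hm j kj; have [mq' sub' hz'] := hm j.+1 (leqW kj).
  have [[m' [d [m'q da E]]]|[i iq E]] := index_split a_gt0 j0 mq'.
    exists d => //; rewrite E; congr addn.
    apply: (level_closure_inj m'q mq _ hz).
    apply: closure_subset hz'; apply: image_subset.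
    by rewrite E; exact: cut_sub_level.
  (* a spacer cannot lie inside a level of an earlier column *)
  have [_ [x hx _] _] := closure_complex hz' ltr01.
  have hxk : col j x by apply: (column_le a_gt0 kj); exists n => //; exact: sub'.
  have [_ disj] := s_valid j0.
  have : (spacer a s j i `&` col j) x by split => //; rewrite /spacer -E.
  by rewrite disj.
have wid := width_gt0 a_gt0.
(* the selected levels are nested intervals *)
have Lmono j l : (k <= j)%N ->
    L j <= L (j + l)%N /\ L (j + l)%N + width a (j + l) <= L j + width a j.
  move=> kj; elim: l => [|l [IH1 IH2]]; first by rewrite addn0.
  have kl : (k <= j + l)%N by lia.
  have l0 : (0 < j + l)%N by lia.
  have [d da E] := step _ kl; have [mq _ _] := hm _ kl.
  have EL : L (j + l).+1 = L (j + l)%N + d%:R * width a (j + l).+1.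
    by rewrite /L E left_end_cut.
  rewrite addnS EL.
  have w0 := wid R (j + l).+1.
  have d1 : 0 <= d%:R * width a (j + l).+1 :> R by rewrite mulr_ge0 // ltW.
  have : (d.+1)%:R * width a (j + l).+1 <= width a (j + l) :> R.
    by rewrite [leRHS](width_cut a_gt0) // ler_pM2r // ler_nat.
  rewrite -natr1 mulrDl mul1r => d2; split; lra.
pose S := [set L (k + l)%N | l in [set: nat]].
have supS : has_sup S.
  split; first by exists (L (k + 0)%N), 0%N.
  exists (L k + width a k) => _ [l _ <-]; have [_] := Lmono k l (leqnn k).
  by have := wid R (k + l)%N; lra.
pose x := sup S.
have xR j : (k <= j)%N -> L j <= x <= L j + width a j.
  move=> kj; apply/andP; split.
    by apply: sup_upper_bound => //; exists (j - k)%N => //; rewrite subnKC.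
  apply: ge_sup; first by exists (L (k + 0)%N), 0%N.
  move=> _ [l _ <-]; have [jl|lj] := leqP j (k + l).
    have := Lmono j (k + l - j)%N kj; rewrite subnKC // => -[_].
    by have := wid R (k + l)%N; lra.
  have kl : (k <= k + l)%N by exact: leq_addr.
  have := Lmono (k + l)%N (j - (k + l))%N kl; rewrite subnKC; last exact: ltnW.
  by move=> [h _]; have := wid R j; lra.
have xL j : (k <= j)%N -> L j < x.
  move=> kj; have /andP[h _] := xR j kj; rewrite lt_neqAle h andbT.
  apply/eqP => E; apply: nphase; exists (m j) => //.
  (* the left ends are constant from j on, so every later digit is 0 *)
  have const l : m (j + l)%N = m j.
    elim: l => [|l IH]; first by rewrite addn0.
    have kl : (k <= j + l)%N by lia.
    have [d da Ed] := step _ kl; rewrite addnS Ed IH.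
    have [mq _ _] := hm _ kl; have l0 : (0 < j + l)%N by lia.
    have := Lmono j (l.+1) kj; have /andP[+ _] := xR (j + l.+1)%N ltac:(lia).
    have := Lmono j l kj; have /andP[+ _] := xR (j + l)%N ltac:(lia).
    rewrite -E => h1 [h2 _] h3 [h4 _].
    have e1 : L (j + l)%N = L j by apply/eqP; rewrite eq_le h1 h2.
    have e2 : L (j + l.+1)%N = L j by apply/eqP; rewrite eq_le h3 h4.
    have EL : L (j + l).+1 = L (j + l)%N + d%:R * width a (j + l).+1.
      by rewrite /L Ed left_end_cut.
    move: e2; rewrite addnS EL e1.
    move=> /eqP; rewrite -[X in _ == X]addr0 (inj_eq (addrI _)) mulf_eq0.
    by rewrite (gt_eqF (wid R _)) orbF pnatr_eq0 => /eqP ->.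
  apply/eqP; rewrite -subr_eq0; apply/eqP/eq0_normc/eqP; rewrite eq_le normc_ge0 andbT.
  apply/ler_addgt0Pr => e e0; rewrite add0r.
  have [N N0 hN] := level_closure_near e0.
  have kN : (k <= j + N)%N by lia.
  have [mq _ hz] := hm _ kN.
  by rewrite ltW // -(const N); apply: (hN (j + N)%N) => //; exact: leq_addl.
have lx j : (k <= j)%N -> lev j (m j) x.
  by move=> kj; apply/levelE; rewrite xL //; have /andP[_] := xR j kj.
exists x; first by have [_ sub _] := hm k (leqnn k); apply: sub; exact: lx.
apply/eqP; rewrite -subr_eq0; apply/eqP/eq0_normc/eqP; rewrite eq_le normc_ge0 andbT.
apply/ler_addgt0Pr => e e0; rewrite add0r; have e20 : 0 < e / 2 by lra.
have [N N0 hN] := level_closure_near e20; have [M M0 hM] := eigenfunction_near e20.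
pose K := maxn k (maxn N M).
have kK : (k <= K)%N by rewrite /K; lia.
have [mq _ hz] := hm K kK.
have := hM K x ltac:(rewrite /K; lia) (level_sub_column mq (lx K kK)).
rewrite (level_index_unique a_gt0 s_valid mq (lx K kK)).
have := hN K (m K) z ltac:(rewrite /K; lia) mq hz.
have := normc_triangle (phase (m K)) (f x) z; rewrite (normc_distC (f x) (phase (m K))); lra.
Qed.

(** The image differs from a Borel set by a subset of the countable set of
    powers of lambda. *)
Lemma level_image_measurable k n : (n < q k)%N ->
  measurable ((eigenfunction alpha s) @` lev k n).
Proof.
move=> nq.
have cP : countable (range phase) by exact: card_image_le.
have mcount (A : set (borelC R)) : A `<=` range phase -> measurable A.
  move=> AP; apply: countable_measurable; first exact: borelC_set1.
  exact: sub_countable (subset_card_le AP) cP.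
rewrite (_ : _ @` _ = (level_trap k n `\` range phase) `|`
    ((eigenfunction alpha s @` lev k n) `&` range phase)).
  apply: measurableU; last by apply: mcount => z [].
  apply: measurableD; first exact: level_trap_measurable.
  exact: mcount.
apply/seteqP; split => z.
  move=> hz; have [hp|hp] := pselect (range phase z); [by right|left].
  by split => //; exact: level_trap_image.
by move=> [/level_trap_sub|[]//]; exact.
Qed.

End NotGolden.
End EigenfunctionTheory.

(** * The isomorphism with the image system *)

Section IsomorphismTheorem.
Context {R : realType} (alpha : R) (s : nat -> nat -> R).
Hypothesis alpha_irr : irrational alpha.
Hypothesis alpha_ngold : ~ golden_type alpha.
Hypothesis s_valid : valid_spacers (cuts alpha) s.

Local Notation a := (cuts alpha).
Local Notation q := (height a).
Local Notation lev := (level a s).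
Local Notation col := (column a s).
Local Notation X := (tower_space a s).
Local Notation T := (tower_map a s).
Local Notation f := (eigenfunction alpha s).
Local Notation idx := (level_index a s).
Local Notation C := (R[i]^o).

Let a_gt0 := cuts_gt0 alpha_irr.
Let w_small := @width_small R a a_gt0 (cuts_ge2 alpha_irr alpha_ngold).

Lemma arc_measurable (u v : R) : measurable (turn @` `[u, v] : set (borelC R)).
Proof.
apply: closed_borelC; apply: compact_closed; first exact: complex_hausdorff.
apply: (@continuous_compact _ _ (turn : R -> C)); last exact: segment_compact.
by apply: continuous_subspaceT; exact: continuous_turn.
Qed.

Lemma circleE (z : borelC R) : circle R z <-> normc z = 1.
Proof.
split => h; first exact: (@complexI R (normc z) 1 h).
by rewrite /circle /= -[LHS]/((normc z)%:C) h.
Qed.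

Lemma circle_turn : circle R = turn @` `[0, 1].
Proof.
apply/seteqP; split => z.
  move=> /circleE /turn_surj[t /andP[t0 t1] ->]; exists t => //=.
  by rewrite in_itv /= t0 ltW.
by move=> [t _ <-]; apply/circleE; exact: normc_turn.
Qed.

Lemma measurable_circle : measurable (circle R).
Proof. by rewrite circle_turn; exact: arc_measurable. Qed.

Lemma rotationE (z : R[i]) : rotation alpha z = turn alpha * z.
Proof. by []. Qed.

Lemma rotation_circle : set_fun (circle R) (circle R) (rotation alpha).
Proof.
move=> z /circleE z1; apply/circleE.
by rewrite rotationE normcM normc_turn mul1r.
Qed.

Lemma measurable_rotation : measurable_fun (circle R) (rotation alpha).
Proof.
apply: measurability => //= _ [U oU <-].
apply: measurableI; first exact: measurable_circle.
apply: open_borelC; apply: (@open_comp C C (fun z => turn alpha * z) U) => // z _.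
exact: mulrl_continuous.
Qed.

Lemma eigenfunction_circle_set : set_fun X (circle R) f.
Proof. by move=> x hx; apply/circleE; exact: eigenfunction_circle. Qed.

(** Invariance of Lebesgue measure under the tower map, transported by the
    equivariance of f. *)
Lemma image_measure_rotation : measure_preserving (circle R)
  (image_measure alpha s) (rotation alpha).
Proof.
split; [exact: measurable_circle|exact: rotation_circle|exact: measurable_rotation|].
move=> A mA AS; rewrite /image_measure.
have mf := eigenfunction_measurable alpha_irr s_valid.
have mX : measurable X by exact: measurable_tower_space.
rewrite -[in RHS](setIid X) -setIA.
have -> : X `&` f @^-1` (circle R `&` rotation alpha @^-1` A) =
    X `&` T @^-1` (X `&` f @^-1` A).
  apply/seteqP; split => x /= [hx].
    move=> [_ hA]; split => //; split; first exact: tower_map_stable.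
    by rewrite eigenfunction_equivariant.
  move=> [_ hA]; split => //; split; first exact: eigenfunction_circle_set.
  by rewrite rotationE -eigenfunction_equivariant.
by rewrite (tower_map_measure a_gt0 s_valid w_small) // ?setIA ?setIid //; exact: mf.
Qed.

(** Images of Borel sets under f are handled as preimages under this inverse.
    *)
Definition eigen_inverse (z : borelC R) : R := xget 0 [set x | X x /\ f x = z].

Lemma eigen_inverseK x : X x -> eigen_inverse (f x) = x.
Proof.
move=> hx; rewrite /eigen_inverse; case: xgetP => [y _ [hy]|/(_ x)[]//].
exact: (eigenfunction_inj alpha_irr s_valid alpha_ngold).
Qed.

Lemma image_levels (P : set R) : (forall x, X x -> P x -> exists k n,
    [/\ (n < q k)%N, lev k n x & lev k n `<=` P]) ->
  measurable (f @` (X `&` P)).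
Proof.
move=> h; have -> : f @` (X `&` P) =
    \bigcup_k \bigcup_(n in [set n | (n < q k)%N /\ lev k n `<=` P]) (f @` lev k n).
  apply/seteqP; split => z.
    move=> [x [hx Px] <-]; have [k [n [nq hn sub]]] := h x hx Px.
    by exists k => //; exists n => //; exists x.
  move=> [k _ [n [nq sub] [x hx <-]]]; exists x => //; split; last exact: sub.
  by exists k => //; exists n.
apply: bigcupT_measurable => k; apply: bigcup_measurable => n [nq _].
exact: level_image_measurable.
Qed.

Lemma measurable_image_space : measurable (f @` X).
Proof.
rewrite -[X]setIT; apply: image_levels => x [k _ [n nq h]] _.
by exists k, n; split.
Qed.

(** It suffices to treat open rays; the points of X in a ray are covered by
    the levels contained in it, because the widths tend to 0. *)
Lemma measurable_eigen_inverse : measurable_fun (f @` X) eigen_inverse.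
Proof.
apply: (measurability _ (RGenOInfty.measurableE R)) => //= _ [_ [u ->] <-].
have -> : f @` X `&` eigen_inverse @^-1` `]u, +oo[ = f @` (X `&` `]u, +oo[).
  apply/seteqP; split => z.
    by move=> [[x hx <-]]; rewrite /= eigen_inverseK // => ux; exists x.
  by move=> [x [hx ux] <-]; split; [exists x|rewrite /= eigen_inverseK].
apply: image_levels => x [k _ hx]; rewrite /= in_itv /= andbT => ux.
have d0 : 0 < x - u by lra.
have [N hN] := w_small d0; pose K := maxn N k.
have [iq hi] := level_indexP (column_le a_gt0 (leq_maxr N k) hx).
exists K, (idx K x); split => // y hy; rewrite /= in_itv /= andbT.
move: hi hy => /levelE/andP[? ?] /levelE/andP[? ?].
have := hN K (leq_maxl _ _); rewrite -/K in iq *; lra.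
Qed.

Lemma measurable_eigen_image (A : set R) : measurable A -> A `<=` X ->
  measurable (f @` A).
Proof.
move=> mA AX; have -> : f @` A = f @` X `&` eigen_inverse @^-1` A.
  apply/seteqP; split => z.
    move=> [x Ax <-]; split; first by exists x => //; exact: AX.
    by rewrite /= eigen_inverseK //; exact: AX.
  by move=> [[x hx <-]]; rewrite /= eigen_inverseK // => Ax; exists x.
by apply: measurable_eigen_inverse => //; exact: measurable_image_space.
Qed.

(** The invariant sets of full measure are X itself and f(X). *)
Lemma eigenfunction_isomorphism : isomorphism X lebesgue_measure T
  (circle R) (image_measure alpha s) (rotation alpha) f.
Proof.
split.
- exact: tower_map_measure_preserving.
- exact: image_measure_rotation.
exists X, (f @` X); split.
- split => //; [exact: measurable_tower_space|by rewrite setDv measure0|].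
  exact: tower_map_stable.
- split.
  + exact: measurable_image_space.
  + by move=> _ [x hx <-]; exact: eigenfunction_circle_set.
  + rewrite /image_measure (_ : X `&` _ = set0) ?measure0 // -subset0 => x [hx [_]].
    by apply; exists x.
  + move=> _ [x hx <-]; exists (T x); first exact: tower_map_stable.
    by rewrite eigenfunction_equivariant.
- split; last by move=> x hx; rewrite eigenfunction_equivariant.
  split; [by move=> x hx; exists x| |by move=> z].
  move=> x y /set_mem hx /set_mem hy.
  exact: (eigenfunction_inj alpha_irr s_valid alpha_ngold).
- split; last exact: measurable_eigen_image.
  exact: eigenfunction_measurable.
- by [].
Qed.

End IsomorphismTheorem.

(** * Invariant measures of an irrational rotation *)

Section UniqueErgodicity.
Context {R : realType} (alpha : R).
Hypothesis alpha_irr : irrational alpha.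

Local Notation q := (height (cuts alpha)).
Local Notation rot := (rotation alpha).

Let theta : R := cq_frac alpha 0.

(** A positive error q_k alpha - p_k (k odd) smaller than v - u has a multiple
    strictly between u and v. *)
Lemma orbit_dense (u v : R) : 0 <= u -> u < v ->
  exists (n : nat) (m : int), u < n%:R * theta - m%:~R < v.
Proof.
move=> u0 uv; have d0 : 0 < v - u by rewrite subr_gt0.
have [N hN] := gap_small alpha_irr d0; pose k := N.*2.+1.
have gk : gap alpha k < v - u by apply: hN; rewrite /k; lia.
have g0 := gap_gt0 alpha_irr k; set d := gap alpha k in gk g0.
pose j := (Num.truncn (u / d)).+1.
have ud0 : 0 <= u / d by rewrite divr_ge0 // ltW.
have /andP[j1 j2] := truncn_itv ud0.
have h1 : u < j%:R * d by rewrite -ltr_pdivrMr.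
have h2 : j%:R * d < v.
  have : (Num.truncn (u / d))%:R * d <= u by rewrite -ler_pdivlMr.
  by rewrite /j -natr1 mulrDl mul1r; lra.
exists (j * q k)%N, (Posz j * numer alpha k - Posz (j * q k) * Num.floor alpha).
suff -> : (j * q k)%:R * theta -
    (Posz j * numer alpha k - Posz (j * q k) * Num.floor alpha)%:~R = j%:R * d.
  by rewrite h1 h2.
have E := convergent_error alpha_irr k.
have s1 : (-1) ^+ k.+1 = 1 :> R by rewrite /k -doubleS -mul2n exprM sqrrN !expr1n.
rewrite s1 mul1r -/d in E; rewrite -E /theta /cq_frac /=.
rewrite intrB !intrM -![(Posz _)%:~R]/(_%:R) natrM; ring.
Qed.

Variable nu : {measure set (borelC R) -> \bar R}.
Hypothesis nu_fin : (nu [set: borelC R] < +oo)%E.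
Hypothesis nu_circle : nu (~` circle R) = 0%E.
Hypothesis nu_rot : forall A, measurable A -> nu (rot @^-1` A) = nu A.

Let M : R := fine (nu [set: borelC R]).

Lemma halfopen_arc_measurable (u v : R) :
  measurable (turn @` `[u, v[ : set (borelC R)).
Proof.
rewrite itv_bnd_open_bigcup image_bigcup.
by apply: bigcupT_measurable => n; exact: arc_measurable.
Qed.

Lemma nu_finite A : measurable A -> nu A \is a fin_num.
Proof.
move=> mA; rewrite ge0_fin_numE ?measure_ge0 //.
apply: le_lt_trans nu_fin; apply: le_measure => //; rewrite inE //; exact: measurableT.
Qed.

Definition arc (u v : R) : R := fine (nu (turn @` `[u, v[)).

Lemma arc_ge0 u v : 0 <= arc u v.
Proof. by rewrite fine_ge0. Qed.

Lemma arcE u v : nu (turn @` `[u, v[) = (arc u v)%:E.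
Proof. by rewrite fineK // nu_finite //; exact: halfopen_arc_measurable. Qed.

(** A half-open arc of at most one turn is covered without overlap by its two
    parts. *)
Lemma arc_split u v w : u <= v -> v <= w -> w <= u + 1 ->
  arc u w = arc u v + arc v w.
Proof.
move=> uv vw wu; apply: EFin_inj; rewrite EFinD -!arcE.
rewrite -measureU; try exact: halfopen_arc_measurable.
  congr (nu _); rewrite -image_setU; congr (_ @` _).
  apply/seteqP; split => x /=; rewrite !in_itv /=.
    move=> /andP[h1 h2]; have [xv|vx] := ltP x v; [left|right]; apply/andP; split; lra.
  by move=> [] /andP[h1 h2]; apply/andP; split; lra.
rewrite -subset0 => z [[x +<-] [y + yx]]; rewrite /= !in_itv /= => /andP[x1 x2] /andP[y1 y2].
have [p hp] := turn_inj yx.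
have p1 : (0 < p)%R by rewrite -(ltr0z R) -hp; lra.
have p2 : (p < 1)%R by rewrite -(ltrz1 R) -hp; lra.
lia.
Qed.

Lemma nu_on_circle B : measurable B -> nu B = nu (circle R `&` B).
Proof.
move=> mB; have mc := measurable_circle (R := R).
have n0 : nu (B `\` circle R) = 0%E.
  apply/eqP; rewrite eq_le measure_ge0 andbT -nu_circle.
  apply: le_measure; rewrite ?inE; [exact: measurableD|exact: measurableC|].
  by move=> z [].
by rewrite (measureDI nu mB mc) [X in (X + _)%E]n0 add0e setIC.
Qed.

Lemma arc_full : arc 0 1 = M.
Proof.
have mc := measurable_circle (R := R).
have nuT : nu [set: borelC R] = nu (circle R).
  rewrite -(setUv (circle R)).
  have -> : nu (circle R `|` ~` circle R) = (nu (circle R) + nu (~` circle R))%E.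
    by apply: measureU => //; [exact: measurableC|exact: setICr].
  by rewrite nu_circle adde0.
rewrite /arc /M nuT; congr (fine (nu _)); apply/seteqP; split => z.
  by move=> [t _ <-]; apply/circleE; exact: normc_turn.
by move=> /circleE/turn_surj[t t01 ->]; exists t.
Qed.

Lemma arc_int u v (p : int) : arc (u + p%:~R) (v + p%:~R) = arc u v.
Proof.
congr (fine (nu _)); apply/seteqP; split => z [t]; rewrite /= in_itv /= => /andP[h1 h2] <-.
  exists (t - p%:~R); first by rewrite /= in_itv /=; apply/andP; split; lra.
  by rewrite -[in RHS](subrK p%:~R t) [RHS]turnD turn_int mulr1.
exists (t + p%:~R); first by rewrite /= in_itv /=; apply/andP; split; lra.
by rewrite turnD turn_int mulr1.
Qed.

Lemma arc_rot u v : arc (u + alpha) (v + alpha) = arc u v.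
Proof.
rewrite /arc -[in LHS]nu_rot; last exact: halfopen_arc_measurable.
congr (fine (nu _)); apply/seteqP; split => z.
  move=> [t]; rewrite /= in_itv /= => /andP[h1 h2] E.
  exists (t - alpha); first by rewrite /= in_itv /=; apply/andP; split; lra.
  rewrite rotationE in E.
  by rewrite addrC turnD E mulrA [_ * turn alpha]mulrC turnN mul1r.
move=> [t]; rewrite /= in_itv /= => /andP[h1 h2] <-.
exists (t + alpha); first by rewrite /= in_itv /=; apply/andP; split; lra.
by rewrite rotationE addrC turnD.
Qed.

Lemma arc_theta u v : arc (u + theta) (v + theta) = arc u v.
Proof.
have -> : theta = alpha + (- Num.floor alpha)%:~R.
  by rewrite /theta /cq_frac intrN.
by rewrite !addrA arc_int arc_rot.
Qed.

Let F t : R := arc 0 t.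

Lemma F_monotone u v : 0 <= u -> u <= v -> v <= 1 -> F u <= F v.
Proof.
by move=> u0 uv v1; rewrite /F (arc_split u0 uv) ?add0r // lerDl arc_ge0.
Qed.

Lemma F_le t : 0 <= t <= 1 -> F t <= M.
Proof. by move=> /andP[t0 t1]; rewrite -arc_full; exact: F_monotone. Qed.

(** Induction on n, subtracting theta modulo 1: a wrap-around changes m by 1
    and crosses the whole circle, of mass M, once. *)
Lemma F_orbit (n : nat) (m : int) (t : R) : 0 <= t < 1 ->
  t = n%:R * theta - m%:~R -> F t = n%:R * F theta - m%:~R * M.
Proof.
have th0 : 0 < theta by exact: cq_frac_gt0.
have th1 : theta < 1 by exact: cq_frac_lt1.
elim: n m t => [|n IH] m t /andP[t0 t1] tE.
  rewrite mul0r sub0r in tE.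
  have m0 : m = 0.
    have : -1 < m%:~R :> R by lra.
    have : m%:~R <= 0 :> R by lra.
    rewrite lerz0 -[-1](mulrN1z 1) ltr_int; lia.
  rewrite tE m0 oppr0 !mul0r subrr /F /arc set_itvco0 image_set0 measure0 //.
have [tt|tt] := leP theta t.
  have E := IH m (t - theta) _ _.
  have -> : F t = F theta + F (t - theta).
    rewrite /F (arc_split (ltW th0) tt); last lra.
    by rewrite -(arc_theta 0 (t - theta)) add0r subrK.
  rewrite E; first by rewrite -natr1; ring.
    by apply/andP; split; lra.
  by rewrite tE -natr1; ring.
have E := IH (m - 1) (t - theta + 1) _ _.
have E2 : F (t - theta + 1) = M - F theta + F t.
  rewrite -arc_full /F (arc_split (ltW th0) (ltW th1)) ?add0r //.
  rewrite -(arc_theta 0 (t - theta + 1)) add0r.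
  rewrite (@arc_split theta 1) //; last 3 first.
  - exact: ltW.
  - by lra.
  - by lra.
  have -> : arc 1 (t - theta + 1 + theta) = arc 0 t.
    by rewrite -(arc_int 0 t 1); congr arc; ring.
  ring.
have : F (t - theta + 1) = n%:R * F theta - (m - 1)%:~R * M.
  apply: E; first by apply/andP; split; lra.
  by rewrite tE -natr1 intrB; ring.
by rewrite E2 intrB -natr1; lra.
Qed.

(** By [F_orbit], n (F theta - M theta) is a difference of two numbers in
    [0, M], for every n. *)
Lemma F_theta : F theta = M * theta.
Proof.
have th0 : 0 < theta by exact: cq_frac_gt0.
have M0 : 0 <= M by rewrite fine_ge0.
(* t is the fractional part of n theta *)
have h (n : nat) : n%:R * `|F theta - M * theta| <= M.
  pose t := n%:R * theta - (Num.floor (n%:R * theta))%:~R.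
  have /andP[f1 f2] := floor_itv (n%:R * theta).
  have t01 : 0 <= t < 1.
    by rewrite /t; move: f2; rewrite intrD => f2; apply/andP; split; lra.
  have E := F_orbit t01 erefl; have Ft0 : 0 <= F t by exact: arc_ge0.
  have Ft1 : F t <= M by apply: F_le; case/andP: t01 => -> /ltW.
  rewrite -[X in X * _]normr_nat -normrM.
  have -> : n%:R * (F theta - M * theta) = F t - M * t by rewrite E /t; ring.
  case/andP: t01 => t0 t1; rewrite ler_norml; apply/andP; split; nra.
apply/eqP; rewrite -subr_eq0 -normr_le0 leNgt; apply/negP => d0.
have := h (Num.truncn (M / `|F theta - M * theta|)).+1.
by rewrite -ler_pdivlMr // leNgt truncnS_gt.
Qed.

(** If F t and M t differ, an orbit point, where F is linear, separates
    F t / M from t and contradicts monotonicity. *)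
Lemma F_linear t : 0 <= t <= 1 -> F t = M * t.
Proof.
move=> t01; have /andP[t0 t1] := t01.
have Ft0 : 0 <= F t by exact: arc_ge0.
have Ft1 := F_le t01.
have [M0|M0] := leP M 0; first by nra.
have h (u v : R) : 0 <= u -> u < v -> v <= 1 -> exists2 r, u < r < v & F r = M * r.
  move=> u0 uv v1; have [n [m r]] := orbit_dense u0 uv; case/andP: (r) => r1 r2.
  exists (n%:R * theta - m%:~R) => //.
  rewrite (F_orbit _ erefl) ?F_theta; first ring.
  by apply/andP; split; lra.
have FM : F t = M * (F t / M) by rewrite mulrC divfK // gt_eqF.
have F0 : 0 <= F t / M by rewrite divr_ge0 // ltW.
have F1 : F t / M <= 1 by rewrite ler_pdivrMr // mul1r.
have [lt|gt|//] := ltgtP (F t) (M * t).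
  rewrite FM ltr_pM2l // in lt; have [r /andP[r1 r2] Er] := h _ _ F0 lt t1.
  have : F r <= F t by apply: F_monotone => //; lra.
  by rewrite Er FM ler_pM2l //; lra.
rewrite FM ltr_pM2l // in gt; have [r /andP[r1 r2] Er] := h _ _ t0 gt F1.
have : F t <= F r by apply: F_monotone => //; lra.
by rewrite Er FM ler_pM2l //; lra.
Qed.

(** The argument in [0, 1[ of a point of the circle; 0 off the circle. *)
Definition angle (z : borelC R) : R := xget 0 [set t | 0 <= t < 1 /\ turn t = z].

Lemma angle_itv z : 0 <= angle z < 1.
Proof. by rewrite /angle; case: xgetP => [t _ []//|_]; rewrite lexx ltr01. Qed.

Lemma angleK z : circle R z -> turn (angle z) = z.
Proof.
move=> /circleE/turn_surj[t t01 E]; rewrite /angle; case: xgetP => [u _ [] //|/(_ t)[]].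
by rewrite E.
Qed.

Lemma turn_angle t : 0 <= t < 1 -> angle (turn t) = t.
Proof.
move=> /andP[t0 t1]; have /andP[a0 a1] := angle_itv (turn t).
have /turn_inj[p hp] : turn (angle (turn t)) = turn t.
  by apply: angleK; apply/circleE; exact: normc_turn.
have : (-1 < p < 1)%R.
  by rewrite -(ltrz1 R) -(ltr_int R (-1)) -hp mulrN1z; apply/andP; split; lra.
by move=> p1; have p0 : p = 0 by [lia]; rewrite p0 in hp; lra.
Qed.

Lemma angle_ray (b : R) : 0 < b <= 1 ->
  circle R `&` angle @^-1` `]-oo, b[ = turn @` `[0, b[.
Proof.
move=> /andP[b0 b1]; apply/seteqP; split => z.
  move=> [cz]; rewrite /= in_itv /= => zb; exists (angle z); last exact: angleK.
  by rewrite /= in_itv /= zb andbT; have /andP[] := angle_itv z.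
move=> [t]; rewrite /= in_itv /= => /andP[t0 tb] <-; split.
  by apply/circleE; exact: normc_turn.
by rewrite /= in_itv /= turn_angle // t0 (lt_le_trans tb).
Qed.

Lemma angle_off_circle z : ~ circle R z -> angle z = 0.
Proof.
move=> cz; rewrite /angle; case: xgetP => // t _ [_ tz]; exfalso; apply: cz.
by rewrite -tz; apply/circleE; exact: normc_turn.
Qed.

Lemma measurable_angle : measurable_fun setT angle.
Proof.
apply: (measurability _ (RGenInftyO.measurableE R)) => //= _ [_ [b ->] <-].
rewrite setTI; have mc := measurable_circle (R := R).
have [b0|b0] := leP b 0.
  rewrite (_ : _ @^-1` _ = set0) // -subset0 => z; rewrite /= in_itv /=.
  by have /andP[] := angle_itv z; lra.
have [b1|b1] := leP b 1.
  rewrite (_ : _ @^-1` _ = turn @` `[0, b[ `|` ~` circle R).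
    by apply: measurableU; [exact: halfopen_arc_measurable|exact: measurableC].
  rewrite -angle_ray ?b0 //; apply/seteqP; split => z /=.
    by move=> h; have [cz|cz] := pselect (circle R z); [left|right].
  move=> [[]//|cz]; rewrite in_itv /= angle_off_circle //.
rewrite (_ : _ @^-1` _ = setT); first exact: measurableT.
apply/seteqP; split => // z _; rewrite /= in_itv /=.
by have /andP[] := angle_itv z; lra.
Qed.

(** The distribution of [angle] under nu and M times Lebesgue measure on
    [0, 1[ agree on rays by [F_linear], hence on all Borel sets. *)
Lemma unique_ergodicity A : measurable A ->
  nu A = (M%:E * circle_lebesgue A)%E.
Proof.
move=> mA.
have mI : measurable (`[0, 1[%classic : set R) by exact: measurable_itv.
have M0 : 0 <= M by rewrite fine_ge0.
(* the measure structure of a pushforward takes the proof of measurability as an argument *)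
pose m1 : {measure set (measurableTypeR R) -> \bar R} :=
  measure_function_pushforward__canonical__measure_function_Measure nu
    (measurable_angle : measurable_fun setT (angle : _ -> measurableTypeR R)).
pose m2 : {measure set (measurableTypeR R) -> \bar R} :=
  mscale (NngNum M0) (mrestr lebesgue_measure mI).
have m1E B : measurable B -> m1 B = m2 B.
  apply: (@measure_unique _ R (measurableTypeR R) (@RGenInftyO.G R)
    (fun n => `]-oo, n%:R[%classic) _ _ _ _ m1 m2) => //.
  - exact: RGenInftyO.measurableE.
  - move=> _ _ [u ->] [v ->]; exists (Num.min u v).
    by apply/seteqP; split => x /=; rewrite !in_itv /= lt_min => /andP.
  - by move=> n; exists n%:R.
  - apply/seteqP; split => // x _; exists (Num.truncn x).+1 => //=.
    by rewrite in_itv /= truncnS_gt.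
  - move=> _ [b ->]; rewrite -[LHS]/(nu (angle @^-1` `]-oo, b[)).
    rewrite -[RHS]/(M%:E * lebesgue_measure (`]-oo, b[ `&` `[0%R, 1%R[))%E.
    have mb : measurable (angle @^-1` `]-oo, b[).
      by rewrite -[X in measurable X]setTI; apply: measurable_angle.
    have [b0|b0] := leP b 0.
      rewrite (_ : _ @^-1` _ = set0); last first.
        rewrite -subset0 => z; rewrite /= in_itv /=.
        by have /andP[] := angle_itv z; lra.
      rewrite (_ : _ `&` _ = set0) ?measure0 ?mule0 // -subset0 => x [].
      by rewrite /= !in_itv /= => h /andP[]; lra.
    have [b1|b1] := leP b 1.
      rewrite nu_on_circle // angle_ray ?b0 // arcE -/(F b) F_linear ?b1 ?ltW //.
      rewrite (_ : _ `&` _ = `[0, b[%classic) ?lebesgue_measure_itv /= ?lte_fin ?b0.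
        by rewrite sube0.
      apply/seteqP; split => x; rewrite /= !in_itv /=.
        by move=> [h /andP[-> _]].
      by move=> /andP[h1 h2]; split => //; apply/andP; split; lra.
    rewrite (_ : _ @^-1` _ = setT); last first.
      apply/seteqP; split => // z _; rewrite /= in_itv /=.
      by have /andP[] := angle_itv z; lra.
    rewrite (_ : _ `&` _ = `[0, 1[%classic); last first.
      apply/setIidr => x; rewrite /= !in_itv /= => /andP[]; lra.
    rewrite lebesgue_measure_itv /= lte_fin ltr01 sube0 mule1 fineK //.
    exact: nu_finite.
  - move=> n; have mn : measurable (angle @^-1` `]-oo, n%:R[).
      by rewrite -[X in measurable X]setTI; apply: measurable_angle.
    by have := nu_finite mn; rewrite ge0_fin_numE ?measure_ge0.
have mtA : measurable ((turn : R -> borelC R) @^-1` A).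
  by rewrite -[X in measurable X]setTI; exact: measurable_turn.
have maA : measurable (angle @^-1` (turn @^-1` A)).
  by rewrite -[X in measurable X]setTI; apply: measurable_angle.
rewrite nu_on_circle //.
have -> : circle R `&` A = circle R `&` angle @^-1` (turn @^-1` A).
  by apply/seteqP; split => z /= [cz]; rewrite angleK.
rewrite -nu_on_circle // -[LHS]/(m1 (turn @^-1` A)) m1E //.
by rewrite /circle_lebesgue setIC.
Qed.
End UniqueErgodicity.

(** * The case of finite measure *)

(** The target measure matters only through its values on Borel subsets of the
    target. *)
Lemma isomorphism_eq_measure {R : realType} d1 d2 (T1 : measurableType d1)
    (T2 : measurableType d2) (D1 : set T1) (mu1 : set T1 -> \bar R) (S1 : T1 -> T1)
    (D2 : set T2) (mu2 mu2' : set T2 -> \bar R) (S2 : T2 -> T2) (f : T1 -> T2) :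
  (forall A, measurable A -> A `<=` D2 -> mu2 A = mu2' A) ->
  isomorphism D1 mu1 S1 D2 mu2 S2 f -> isomorphism D1 mu1 S1 D2 mu2' S2 f.
Proof.
move=> E [mp1 [mD2 sD2 mS2 inv2] [E1 [E2 [h1 [mE2 E2D n2 sE2] h3 h4 h5]]]]; split => //.
  split => // A mA AD; rewrite -!E ?inv2 //; first exact: mS2.
exists E1, E2; split => //.
  split => //; rewrite -E //; exact: measurableD.
by move=> B mB BE2; rewrite -E ?h5 //; exact: subset_trans BE2 E2D.
Qed.

Section FiniteSpace.
Context {R : realType} (alpha : R) (s : nat -> nat -> R).
Hypothesis alpha_irr : irrational alpha.
Hypothesis alpha_ngold : ~ golden_type alpha.
Hypothesis s_valid : valid_spacers (cuts alpha) s.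

Local Notation X := (tower_space (cuts alpha) s).
Local Notation f := (eigenfunction alpha s).

Hypothesis X_fin : (lebesgue_measure X < +oo)%E.

Let mX : measurable X := measurable_tower_space (cuts alpha) s.

Lemma measurable_restricted_eigenfunction :
  measurable_fun setT (f \_ X : measurableTypeR R -> borelC R).
Proof.
exact: (measurable_restrictT _ mX).1 (eigenfunction_measurable alpha_irr s_valid).
Qed.

Let nu : {measure set (borelC R) -> \bar R} :=
  measure_function_pushforward__canonical__measure_function_Measure
    (mrestr (@lebesgue_measure R) mX) measurable_restricted_eigenfunction.

Lemma image_measureE A : nu A = image_measure alpha s A.
Proof.
rewrite -[LHS]/(lebesgue_measure ((f \_ X) @^-1` A `&` X)) /image_measure.
congr (lebesgue_measure _); apply/seteqP; split => x /= [].
  by rewrite patchE => + hx; rewrite mem_set.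
by move=> hx; rewrite patchE mem_set.
Qed.

(** The image measure is the distribution of f under Lebesgue measure
    restricted to X, a finite measure carried by the circle and invariant
    under rotation. *)
Lemma image_measure_lebesgue A : measurable A ->
  image_measure alpha s A =
  ((fine (lebesgue_measure X))%:E * circle_lebesgue A)%E.
Proof.
move=> mA; have nuT : nu [set: borelC R] = lebesgue_measure X.
  by rewrite image_measureE /image_measure preimage_setT setIT.
rewrite -image_measureE -nuT; apply: (unique_ergodicity alpha_irr) => //.
- by rewrite nuT.
- rewrite image_measureE /image_measure (_ : _ `&` _ = set0) ?measure0 //.
  rewrite -subset0 => x [hx]; apply.
  exact: (eigenfunction_circle_set alpha_irr s_valid).
- move=> B mB; rewrite !image_measureE.
  have [_ _ mrot inv] := image_measure_rotation alpha_irr alpha_ngold s_valid.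
  have on_circle D : image_measure alpha s D = image_measure alpha s (circle R `&` D).
    congr (lebesgue_measure _); apply/seteqP; split => x /= [hx].
      by move=> hD; split => //; split => //; exact: (eigenfunction_circle_set alpha_irr s_valid).
    by move=> [].
  have mc := measurable_circle (R := R).
  have mcB : measurable (circle R `&` B) by exact: measurableI.
  rewrite [RHS]on_circle -(inv _ mcB (@subIsetl _ _ _)).
  rewrite [LHS]on_circle; congr image_measure; apply/seteqP; split => z /= [cz].
    by move=> hB; split => //; split => //; exact: rotation_circle.
  by move=> [].
Qed.

Lemma tower_space_measure_gt0 : (0 < lebesgue_measure X)%E.
Proof.
apply: (@lt_le_trans _ _ (lebesgue_measure (`]0, 1]%classic : set R))).
  by rewrite lebesgue_measure_itv /= lte_fin ltr01 sube0 lte_fin ltr01.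
apply: le_measure; rewrite ?inE; [exact: measurable_itv|exact: mX|].
move=> x x01; exists 1%N => //; exists 0%N => //.
by rewrite /level /= add0r.
Qed.

End FiniteSpace.

Theorem mainTheorem3 (R : realType) (alpha : R) (s : nat -> nat -> R)
    (alpha_irr : irrational alpha)
    (alpha_ngold : ~ golden_type alpha)
    (s_valid : valid_spacers (cuts alpha) s) :
  let X : set R := tower_space (cuts alpha) s in
  let T : R -> R := tower_map (cuts alpha) s in
  let m : set R -> \bar R := lebesgue_measure in
  let f : R -> borelC R := eigenfunction alpha s in
  let nu : set (borelC R) -> \bar R := image_measure alpha s in
  isomorphism X m T (circle R) nu (rotation alpha) f /\
  ((m X < +oo)%E ->
   exists c : R, [/\ 0 < c,
     forall A : set (borelC R), measurable A -> A `<=` circle R ->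
       nu A = (c%:E * circle_lebesgue A)%E &
     isomorphism X m T (circle R) (fun A => (c%:E * circle_lebesgue A)%E)
       (rotation alpha) f]).
Proof.
move=> X T m f nu.
have iso := eigenfunction_isomorphism alpha_irr alpha_ngold s_valid.
split => // X_fin; exists (fine (m X)).
have nuE A : measurable A -> A `<=` circle R ->
    nu A = ((fine (m X))%:E * circle_lebesgue A)%E.
  by move=> mA _; exact: image_measure_lebesgue.
split => //; last exact: isomorphism_eq_measure iso.
by rewrite fine_gt0 // tower_space_measure_gt0 X_fin.
Qed.
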